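(* Let $0<\alpha<1$, $T>0$ and $E_1=\{(x,t): 0<x<1,\ 0<t\le T\}$. Let $f$ be a given function on $E_1$ and $\varphi_1,\varphi_2,\varphi_3$ given functions of $t$. Then there is at most one regular solution $u$ of the problem $$\partial_{0t}^{\alpha}u-\frac{\partial^3u}{\partial x^3}=f(x,t)\quad\text{in }E_1,$$ $$u(x,0)=0,\qquad u(0,t)=\varphi_1(t),\quad \frac{\partial u}{\partial x}(0,t)=\varphi_2(t),\quad u(1,t)=\varphi_3(t),$$ i.e. at most one function $u\in W_1$ satisfying the equation, the initial condition and the boundary conditions, where $$W_1=\{u(x,t): u\in C^{2,1}(E_1),\ u\in C(\overline{E_1}),\ u_x\in C([0,1)\times(0,T])\}.$$
   Context: For $0<\alpha<1$ the Caputo fractional derivative is $\partial_{0t}^{\alpha}g(t)=\frac{1}{\Gamma(1-\alpha)}\int_0^t\frac{g'(\tau)}{(t-\tau)^{\alpha}}\,d\tau$; applied to $u(x,t)$ it acts in the variable $t$. $C^{2,1}(E)$ denotes functions on $E$ with continuous derivatives up to order 2 in $x$ and order 1 in $t$; a solution is required to satisfy the equation at each point of the domain (so the derivatives appearing in the equation exist there). *)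

(* Defs.v *)
From Stdlib Require Import Reals.
From Coquelicot Require Import Coquelicot.

Open Scope R_scope.

(* Euler's integral; meaningful for 0 < z. *)
Definition Gamma (z : R) : R :=
  RInt_gen (fun s => Rpower s (z - 1) * exp (- s))
    (at_right 0) (Rbar_locally p_infty).

Definition caputo_integrand (alpha : R) (g : R -> R) (t tau : R) : R :=
  Derive g tau / Rpower (t - tau) alpha.

(* The integral over (0,t) is improper at both ends: the kernel is singular at
   tau = t, and g' need not be bounded near tau = 0. *)
Definition ex_caputo (alpha : R) (g : R -> R) (t : R) : Prop :=
  (forall tau, 0 < tau < t -> ex_derive g tau) /\
  ex_RInt_gen (caputo_integrand alpha g t) (at_right 0) (at_left t).

Definition caputo (alpha : R) (g : R -> R) (t : R) : R :=
  / Gamma (1 - alpha) *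
  RInt_gen (caputo_integrand alpha g t) (at_right 0) (at_left t).

(* Same as [is_derive], with the difference quotients restricted to [D]; it is
   one-sided where [x] is an endpoint of the interval [D]. *)
Definition is_derive_within (D : R -> Prop) (g : R -> R) (x l : R) : Prop :=
  filterdiff g (within D (locally x)) (fun h => scal h l).

Definition is_pderive_x (E : R * R -> Prop) (u : R -> R -> R) (x t l : R)
  : Prop :=
  is_derive_within (fun y => E (y, t)) (fun y => u y t) x l.

Definition is_pderive_t (E : R * R -> Prop) (u : R -> R -> R) (x t l : R)
  : Prop :=
  is_derive_within (fun s => E (x, s)) (fun s => u x s) t l.

Definition continuous_on2 (E : R * R -> Prop) (u : R -> R -> R) : Prop :=
  continuous_on E (fun p : R * R => u (fst p) (snd p)).

(* No mixed derivatives are required. *)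
Definition C21 (E : R * R -> Prop) (u : R -> R -> R) : Prop :=
  exists ux uxx ut : R -> R -> R,
    (forall x t, E (x, t) ->
       is_pderive_x E u x t (ux x t) /\
       is_pderive_x E ux x t (uxx x t) /\
       is_pderive_t E u x t (ut x t)) /\
    continuous_on2 E u /\ continuous_on2 E ux /\
    continuous_on2 E uxx /\ continuous_on2 E ut.

Definition has_continuous_pderive_x (E : R * R -> Prop) (u : R -> R -> R)
  : Prop :=
  exists ux : R -> R -> R,
    (forall x t, E (x, t) -> is_pderive_x E u x t (ux x t)) /\
    continuous_on2 E ux.

Definition E1 (T : R) (p : R * R) : Prop :=
  0 < fst p < 1 /\ 0 < snd p <= T.

Definition E1_closure (T : R) (p : R * R) : Prop :=
  0 <= fst p <= 1 /\ 0 <= snd p <= T.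

Definition E1_left (T : R) (p : R * R) : Prop :=
  0 <= fst p < 1 /\ 0 < snd p <= T.

(* Functions on the closure of E1 are total functions whose values outside
   the closure play no role. *)
Definition W1 (T : R) (u : R -> R -> R) : Prop :=
  C21 (E1 T) u /\
  continuous_on2 (E1_closure T) u /\
  has_continuous_pderive_x (E1_left T) u.

Definition regular_solution (alpha T : R) (f : R -> R -> R)
    (phi1 phi2 phi3 : R -> R) (u : R -> R -> R) : Prop :=
  W1 T u /\
  (forall x t, E1 T (x, t) ->
     ex_caputo alpha (fun s => u x s) t /\
     ex_derive_n (fun y => u y t) 3 x /\
     caputo alpha (fun s => u x s) t - Derive_n (fun y => u y t) 3 x = f x t) /\
  (forall x, 0 <= x <= 1 -> u x 0 = 0) /\
  (forall t, 0 < t <= T ->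
     u 0 t = phi1 t /\
     is_pderive_x (E1_left T) u 0 t (phi2 t) /\
     u 1 t = phi3 t).

(* Main.v *)
(** Write [I^g] for the Riemann-Liouville integral of order [g] in time, and let
    [u] be the difference of two solutions.  The energy identity cannot be
    applied to [u] itself: neither [u_xx] at [x = 0] nor [u_x], [u_xx] at
    [x = 1] are controlled.  Integrate the equation over [e < s < t] instead.
    Since the Caputo derivative is the time derivative of [K := I^(1-alpha) u],
    the function [V := U(., t) - U(., e)], [U := I^1 u], satisfies
    [V_xxx = K(., t) - K(., e)], which is continuous up to the boundary.  So [V]
    is [C^3] on [0 <= x <= 1], with [V(0) = V'(0) = V(1) = 0], and
    [int V V_xxx dx = - V'(1)^2 / 2 <= 0].  Letting [e] tend to [0] gives
    [int U K dx <= 0] at every time.  If [int U^2 dx] had a positive maximum at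
    time [t0], then [phi(s) := int U(x, t0) U(x, s) dx <= phi(t0)] for
    [s <= t0], hence the Caputo derivative of [phi] at [t0], which is
    [int U K dx], would be positive.  So [U = 0] and [u = U_t = 0]. *)

Require Import Defs.
From Stdlib Require Import Reals Lra IndefiniteDescription.
From Coquelicot Require Import Coquelicot.

(** Time integration helps because [U] and [K] are continuous on the closed rectangle, whereas
    [u_t], [u_xx] and [u_xxx] are known only inside it. It starts at [e > 0] since nothing bounds
    these derivatives near [t = 0]; the limit in [e] involves only [U] and [K]. The maximum argument
    is run on [U] rather than [u] for the same reason: [K] is the Caputo derivative of [U], whose
    time derivative [u] is continuous up to the boundary, so the sign at a maximum is obtained
    without any bound on [u_t]. Two constructions support this. Continuity of [u_xxx] inside is not
    part of the regularity class; it is read off the equation, through a formula for the Caputo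
    derivative in which [u_t] occurs only at times close to the present. And the difference of the
    solutions is frozen outside the closed rectangle, hence zero for [t <= 0], so that the whole
    history can be integrated over an interval independent of [t]. *)

(** * Integrals depending on a parameter *)

(** Compactness of [[a, b]] upgrades joint continuity at the points [(p, r)] to closeness of [f q]
    and [f p] uniformly in [r]. The parameter space is left general because both time alone and
    space-time pairs occur as parameters. *)
Lemma continuous_RInt_param {A : UniformSpace} (f : A -> R -> R) (a b : R)
    (p : A) :
  a <= b ->
  (forall r, a <= r <= b ->
     continuous (fun q : A * R => f (fst q) (snd q)) (p, r)) ->
  locally p (fun q => ex_RInt (f q) a b) ->
  continuous (fun q => RInt (f q) a b) p.
Proof.
intros Hab Hc Hex.
apply filterlim_locally; intros eps.
(* The integrands will differ by at most [2 * e], so the integrals by at most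
   [2 * e * (b - a) < eps]; the [+ 1] covers [a = b]. *)
set (e := eps / (4 * (b - a + 1))).
assert (He : 0 < e).
{ apply Rdiv_lt_0_compat; [apply cond_pos | lra]. }
assert (Hd : forall r, exists d : posreal, a <= r <= b ->
  forall q r', ball p d q -> Rabs (r' - r) < d -> Rabs (f q r' - f p r) < e).
{ intros r.
  destruct (Rle_dec a r) as [Har | Har];
    [ | exists (mkposreal 1 Rlt_0_1); intros; lra].
  destruct (Rle_dec r b) as [Hrb | Hrb];
    [ | exists (mkposreal 1 Rlt_0_1); intros; lra].
  pose proof (proj1 (filterlim_locally _ _) (Hc r (conj Har Hrb))
    (mkposreal e He)) as [d Hd].
  exists d; intros _ q r' Hq Hr.
  apply (Hd (q, r')); split; [exact Hq | exact Hr]. }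
pose (delta := fun r => proj1_sig (constructive_indefinite_description _ (Hd r))).
assert (Hdelta : forall r, a <= r <= b -> forall q r', ball p (delta r) q ->
  Rabs (r' - r) < delta r -> Rabs (f q r' - f p r) < e).
{ intros r; unfold delta.
  exact (proj2_sig (constructive_indefinite_description _ (Hd r))). }
destruct (compactness_value_1d a b delta) as [d Hcomp].
assert (Huni : forall q r, ball p d q -> a <= r <= b ->
  Rabs (f q r - f p r) <= 2 * e).
{ intros q r Hq Hr.
  (* The covering statement is doubly negated, so it can only be opened while proving a
     contradiction. *)
  apply Rnot_lt_le; intros Hlt.
  apply (Hcomp r Hr); intros [t [Ht [Hrt Hdt]]].
  assert (Hq' : ball p (delta t) q) by (now apply ball_le with d).
  pose proof (Hdelta t Ht q r Hq' Hrt) as H1.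
  pose proof (Hdelta t Ht p r (ball_center _ _) Hrt) as H2.
  assert (H3 : Rabs (f q r - f p r) <=
    Rabs (f q r - f p t) + Rabs (f p r - f p t)).
  { replace (f q r - f p r) with ((f q r - f p t) - (f p r - f p t)) by ring.
    unfold Rminus at 1; rewrite <- (Rabs_Ropp (f p r - f p t)).
    apply Rabs_triang. }
  lra. }
pose proof (locally_singleton _ _ Hex) as Hexp.
generalize (filter_and _ _ Hex (locally_ball p d)).
apply filter_imp; intros q [Hexq Hq].
change (Rabs (RInt (f q) a b - RInt (f p) a b) < eps).
change (Rabs (minus (RInt (f q) a b) (RInt (f p) a b)) < eps).
rewrite <- RInt_minus by assumption.
apply Rle_lt_trans with ((b - a) * (2 * e)).
{ apply abs_RInt_le_const; trivial.
  - now apply @ex_RInt_minus.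
  - intros r Hr; now apply Huni. }
pose proof (cond_pos eps).
assert (e * (4 * (b - a + 1)) = eps) by (unfold e; field; lra).
nra.
Qed.

(** Differentiation under the integral with [df] known only on a strip. The margin [d] beyond
    [[a, b]] is there because the derivative must be jointly continuous on full neighbourhoods of
    [(x, a)] and [(x, b)]. *)
Lemma is_derive_RInt_param_loc (f df : R -> R -> R) (a b x d : R) :
  a <= b -> 0 < d ->
  (forall y r, Rabs (y - x) < d -> a - d < r < b + d ->
     is_derive (fun z => f z r) y (df y r)) ->
  (forall r, a <= r <= b ->
     continuous (fun q : R * R => df (fst q) (snd q)) (x, r)) ->
  locally x (fun y => ex_RInt (f y) a b) ->
  is_derive (fun y => RInt (f y) a b) x (RInt (df x) a b).
Proof.
intros Hab Hd Hder Hc Hex.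
replace (RInt (df x) a b) with (RInt (fun t => Derive (fun u => f u t) x) a b).
2: { apply RInt_ext; intros r; rewrite Rmin_left, Rmax_right by easy; intros Hr.
     apply is_derive_unique, Hder; [ | lra].
     rewrite Rminus_diag, Rabs_R0; lra. }
apply is_derive_RInt_param; trivial.
- exists (mkposreal d Hd); intros y Hy r.
  rewrite Rmin_left, Rmax_right by easy; intros Hr.
  eexists; apply Hder; [exact Hy | lra].
- intros r; rewrite Rmin_left, Rmax_right by easy; intros Hr.
  apply continuity_2d_pt_filterlim.
  replace (Derive (fun z => f z r) x) with (df x r).
  2: { symmetry; apply is_derive_unique, Hder; [ | lra].
       rewrite Rminus_diag, Rabs_R0; lra. }
  refine (filterlim_ext_loc _ _ _ (Hc r Hr)).
  exists (mkposreal d Hd); intros [y s] [Hy Hs]; simpl.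
  change (Rabs (y - x) < d) in Hy; change (Rabs (s - r) < d) in Hs.
  symmetry; apply is_derive_unique, Hder; trivial.
  apply Rabs_def2 in Hs; lra.
Qed.

Definition continuous2 (f : R -> R -> R) (x y : R) : Prop :=
  continuous (fun q : R * R => f (fst q) (snd q)) (x, y).

Lemma continuous2_comp {A : UniformSpace} (f : R -> R -> R) (g h : A -> R)
    (p : A) :
  continuous2 f (g p) (h p) -> continuous g p -> continuous h p ->
  continuous (fun q => f (g q) (h q)) p.
Proof.
intros Hf Hg Hh; exact (continuous_comp_2 g h f p Hg Hh Hf).
Qed.

Lemma ex_RInt_cont (f : R -> R) (a b : R) :
  (forall r, continuous f r) -> ex_RInt f a b.
Proof. intros H; apply (@ex_RInt_continuous R_CompleteNormedModule); intros; apply H. Qed.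

Lemma is_derive_prim (f : R -> R) (a x : R) :
  (forall r, continuous f r) -> is_derive (fun y => RInt f a y) x (f x).
Proof.
intros H; apply (is_derive_RInt f (fun y => RInt f a y) a x); [ | apply H].
apply filter_forall; intros y; apply (@RInt_correct R_CompleteNormedModule), ex_RInt_cont, H.
Qed.

Lemma is_derive_continuous (f : R -> R) (x l : R) :
  is_derive f x l -> continuous f x.
Proof. intros H; apply @ex_derive_continuous; now exists l. Qed.

Lemma continuous2_l (f : R -> R -> R) (x y : R) :
  continuous2 f x y -> continuous (fun z => f z y) x.
Proof.
intros H; apply (continuous2_comp f (fun z => z) (fun _ => y)); trivial.
apply continuous_id. apply continuous_const.
Qed.

Lemma continuous2_r (f : R -> R -> R) (x y : R) :
  continuous2 f x y -> continuous (f x) y.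
Proof.
intros H; apply (continuous2_comp f (fun _ => x) (fun z => z)); trivial.
apply continuous_const. apply continuous_id.
Qed.

(** Fubini by differentiation: with [b] replaced by a variable [z], both sides have derivative
    [RInt (f z) c d] and both vanish at [z = a]. *)
Lemma RInt_swap (f : R -> R -> R) (a b c d : R) :
  a < b -> c <= d -> (forall x y, continuous2 f x y) ->
  RInt (fun x => RInt (f x) c d) a b =
  RInt (fun y => RInt (fun x => f x y) a b) c d.
Proof.
intros Hab Hcd Hf.
assert (Hcont : forall x, continuous (fun x => RInt (f x) c d) x).
{ intros x; apply continuous_RInt_param; trivial.
  - intros r _; apply Hf.
  - apply filter_forall; intros y; apply ex_RInt_cont.
    intros r; apply continuous2_r, Hf. }
assert (Hder : forall z, is_derive (fun z =>
  RInt (fun x => RInt (f x) c d) a z -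
  RInt (fun y => RInt (fun x => f x y) a z) c d) z 0).
{ intros z; replace 0 with (RInt (f z) c d - RInt (f z) c d) by ring.
  apply @is_derive_minus.
  - now apply (is_derive_prim (fun x => RInt (f x) c d)).
  - apply (is_derive_RInt_param_loc (fun z y => RInt (fun x => f x y) a z)
      f c d z 1); trivial; try lra.
    + intros y r _ _; apply (is_derive_prim (fun x => f x r)).
      intros x; apply continuous2_l, Hf.
    + intros r _; apply Hf.
    + apply filter_forall; intros y; apply (@ex_RInt_continuous R_CompleteNormedModule); intros s _.
      (* The upper limit runs over a neighbourhood of an arbitrary [z] and may lie to the left of
         [a]; that case is reduced to the other by reversing the orientation. *)
      assert (Hs : forall q : R, continuous (fun s => RInt (fun x => f x s) a q) s).
      { intros q; destruct (Rle_dec a q) as [Haq | Haq].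
        - apply (continuous_RInt_param (fun s x => f x s)); trivial.
          + intros r _.
            apply (continuous2_comp f (fun q : R * R => snd q) (fun q => fst q)).
            apply Hf. apply continuous_snd. apply continuous_fst.
          + apply filter_forall; intros v; apply ex_RInt_cont; intros x.
            apply continuous2_l, Hf.
        - apply (continuous_ext (fun s => opp (RInt (fun x => f x s) q a))).
          { intros v; apply opp_RInt_swap, ex_RInt_cont; intros x.
            apply continuous2_l, Hf. }
          apply @continuous_opp.
          apply (continuous_RInt_param (fun s x => f x s)); [lra | | ].
          + intros r _.
            apply (continuous2_comp f (fun q : R * R => snd q) (fun q => fst q)).
            apply Hf. apply continuous_snd. apply continuous_fst.
          + apply filter_forall; intros v; apply ex_RInt_cont; intros x.
            apply continuous2_l, Hf. }
      apply Hs. }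
assert (Heq := eq_is_derive _ a b (fun t _ => Hder t) Hab); simpl in Heq.
rewrite RInt_point in Heq.
rewrite (RInt_ext _ (fun _ => 0)) in Heq.
2: { intros; apply (@RInt_point R_CompleteNormedModule). }
rewrite RInt_const in Heq; unfold zero, scal in Heq; simpl in Heq.
unfold mult in Heq; simpl in Heq.
lra.
Qed.

(** * The power substitution *)

(* The substitution [tau = t - r^beta], [beta = 1 / (1 - alpha)], turns
   [(t - tau)^(-alpha) dtau] into [- beta dr]; all weakly singular integrals
   thereby become proper ones. *)
Definition rho (beta r : R) : R := if Rle_dec r 0 then 0 else Rpower r beta.

Lemma rho_gt0 (beta r : R) : 0 < r -> rho beta r = Rpower r beta.
Proof. intros H; unfold rho; destruct (Rle_dec r 0); [lra | easy]. Qed.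

Lemma rho_le0 (beta r : R) : r <= 0 -> rho beta r = 0.
Proof. intros H; unfold rho; destruct (Rle_dec r 0); [easy | lra]. Qed.

Lemma Rpower_gt0 (x y : R) : 0 < Rpower x y.
Proof. apply exp_pos. Qed.

Lemma rho_pos (beta r : R) : 0 < r -> 0 < rho beta r.
Proof. intros H; rewrite rho_gt0 by easy; apply Rpower_gt0. Qed.

Lemma rho_ge0 (beta r : R) : 0 <= rho beta r.
Proof.
destruct (Rle_dec r 0) as [H | H].
- rewrite rho_le0; lra.
- apply Rlt_le, rho_pos; lra.
Qed.

Lemma rho_lt (beta r s : R) :
  0 < beta -> 0 <= r < s -> rho beta r < rho beta s.
Proof.
intros Hb [Hr Hs]; destruct (Req_dec r 0) as [-> | Hr0].
- rewrite rho_le0 by lra; apply rho_pos; lra.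
- rewrite !rho_gt0 by lra; apply Rlt_Rpower_l; lra.
Qed.

Lemma rho_le (beta r s : R) :
  0 < beta -> r <= s -> rho beta r <= rho beta s.
Proof.
intros Hb Hs; destruct (Rle_dec r 0) as [Hr | Hr].
- rewrite rho_le0 by easy; apply rho_ge0.
- destruct (Req_dec r s) as [-> | Hrs]; [lra | ].
  apply Rlt_le, rho_lt; lra.
Qed.

Lemma is_derive_Rpower (r y : R) :
  0 < r -> is_derive (fun x => Rpower x y) r (y * Rpower r (y - 1)).
Proof. intros H; apply is_derive_Reals, derivable_pt_lim_power, H. Qed.

Lemma continuous_Rpower (r y : R) :
  0 < r -> continuous (fun x => Rpower x y) r.
Proof. intros H; eapply is_derive_continuous, is_derive_Rpower, H. Qed.

Lemma locally_gt (a x : R) : a < x -> locally x (fun y => a < y).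
Proof. intros H; apply (open_gt a x H). Qed.

Lemma locally_lt (a x : R) : x < a -> locally x (fun y => y < a).
Proof. intros H; apply (open_lt a x H). Qed.

Lemma is_derive_rho (beta r : R) :
  0 < r -> is_derive (rho beta) r (beta * Rpower r (beta - 1)).
Proof.
intros H; apply (is_derive_ext_loc (fun x => Rpower x beta)).
- generalize (locally_gt 0 r H); apply filter_imp; intros x Hx.
  now rewrite rho_gt0.
- now apply is_derive_Rpower.
Qed.

Lemma continuous_rho (beta r : R) : 0 < beta -> continuous (rho beta) r.
Proof.
intros Hb; destruct (Rlt_dec 0 r) as [Hr | Hr].
{ eapply is_derive_continuous, is_derive_rho, Hr. }
destruct (Req_dec r 0) as [-> | Hr0].
- apply filterlim_locally; intros eps.
  exists (mkposreal (Rpower eps (/ beta)) (Rpower_gt0 _ _)).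
  intros y Hy; rewrite rho_le0 by lra.
  change (Rabs (y - 0) < Rpower eps (/ beta)) in Hy.
  change (Rabs (rho beta y - 0) < eps).
  rewrite Rminus_0_r in *.
  destruct (Rle_dec y 0) as [Hy0 | Hy0].
  + rewrite rho_le0, Rabs_R0 by easy; apply cond_pos.
  + rewrite Rabs_pos_eq in Hy by lra.
    rewrite Rabs_pos_eq, rho_gt0 by (apply rho_ge0 || lra).
    apply Rlt_le_trans with (Rpower (Rpower eps (/ beta)) beta).
    * apply Rlt_Rpower_l; lra.
    * rewrite Rpower_mult, Rinv_l, Rpower_1 by (apply cond_pos || lra); lra.
- apply (continuous_ext_loc _ (fun _ => 0)).
  + assert (Hr' : r < 0) by lra.
    generalize (locally_lt 0 r Hr'); apply filter_imp; intros x Hx.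
    rewrite rho_le0; lra.
  + apply continuous_const.
Qed.

Lemma continuous_shift_rho (beta : R) (g : R -> R) (t r : R) :
  0 < beta -> continuous g (t - rho beta r) ->
  continuous (fun r => g (t - rho beta r)) r.
Proof.
intros Hb Hg; apply (continuous_comp (fun r => t - rho beta r) g); trivial.
apply @continuous_minus; [apply continuous_const | now apply continuous_rho].
Qed.

(** * The fractional integral and its time derivative *)

(** The function [- G (t - rho beta r) * Rpower r (1 - beta)] is differentiated: the chain-rule
    factor [beta * Rpower r (beta - 1)] cancels the weight and leaves [beta * g]. With
    [beta = 1 / (1 - alpha)] the weight is the kernel [(t - tau)^(-alpha)] in the variable [r], and
    [Rpower r (- beta)] comes from the derivative of that kernel; its singularity at [r = 0] forces
    [0 < b]. *)
Lemma RInt_rho_by_parts (beta : R) (G g : R -> R) (t b q : R) :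
  0 < beta -> 0 < b <= q ->
  (forall r, b <= r <= q -> is_derive G (t - rho beta r) (g (t - rho beta r)) /\
     continuous g (t - rho beta r)) ->
  beta * RInt (fun r => g (t - rho beta r)) b q =
  G (t - rho beta b) * Rpower b (1 - beta) -
  G (t - rho beta q) * Rpower q (1 - beta) -
  (beta - 1) * RInt (fun r => G (t - rho beta r) * Rpower r (- beta)) b q.
Proof.
intros Hb Hbq HG.
assert (HcG : forall r, b <= r <= q ->
  continuous (fun r => G (t - rho beta r) * Rpower r (- beta)) r).
{ intros r Hr; apply @continuous_mult; [ | apply continuous_Rpower; lra].
  apply continuous_shift_rho; trivial.
  eapply is_derive_continuous, HG, Hr. }
assert (Hcg : forall r, b <= r <= q ->
  continuous (fun r => g (t - rho beta r)) r).
{ intros r Hr; apply continuous_shift_rho; [trivial | apply HG, Hr]. }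
assert (H1 : is_RInt (fun r => plus (scal beta (g (t - rho beta r)))
    (scal (beta - 1) (G (t - rho beta r) * Rpower r (- beta)))) b q
  (minus (- G (t - rho beta q) * Rpower q (1 - beta))
    (- G (t - rho beta b) * Rpower b (1 - beta)))).
{ apply (is_RInt_derive (fun r => - G (t - rho beta r) * Rpower r (1 - beta))).
  - intros r; rewrite Rmin_left, Rmax_right by lra; intros Hr.
    assert (HG' : is_derive (fun r => G (t - rho beta r)) r
      (scal (0 - beta * Rpower r (beta - 1)) (g (t - rho beta r)))).
    { apply (is_derive_comp G (fun r => t - rho beta r)); [apply HG, Hr | ].
      apply @is_derive_minus; [apply @is_derive_const | ].
      apply is_derive_rho; lra. }
    assert (Hp := is_derive_mult _ _ r _ _ (is_derive_opp _ _ _ HG')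
      (is_derive_Rpower r (1 - beta) ltac:(lra)) Rmult_comm).
    eapply is_derive_ext; [ | refine (eq_ind _ (is_derive _ r) Hp _ _)].
    { intros x; reflexivity. }
    unfold plus, scal, opp, mult; simpl; unfold mult; simpl.
    replace (1 - beta - 1) with (- beta) by ring.
    assert (Hpow : Rpower r (beta - 1) * Rpower r (1 - beta) = 1).
    { rewrite <- Rpower_plus.
      replace (beta - 1 + (1 - beta)) with 0 by ring.
      apply Rpower_O; lra. }
    replace (- ((0 - beta * Rpower r (beta - 1)) * g (t - rho beta r)) *
      Rpower r (1 - beta)) with (beta * g (t - rho beta r) *
      (Rpower r (beta - 1) * Rpower r (1 - beta))) by ring.
    rewrite Hpow; ring.
  - intros r; rewrite Rmin_left, Rmax_right by lra; intros Hr.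
    apply @continuous_plus; apply @continuous_scal_r.
    now apply Hcg. now apply HcG. }
assert (H2 : is_RInt (fun r => plus (scal beta (g (t - rho beta r)))
    (scal (beta - 1) (G (t - rho beta r) * Rpower r (- beta)))) b q
  (plus (scal beta (RInt (fun r => g (t - rho beta r)) b q))
    (scal (beta - 1)
      (RInt (fun r => G (t - rho beta r) * Rpower r (- beta)) b q)))).
{ apply @is_RInt_plus; apply @is_RInt_scal;
    apply (@RInt_correct R_CompleteNormedModule),
    (@ex_RInt_continuous R_CompleteNormedModule); intros r;
    rewrite Rmin_left, Rmax_right by lra; intros Hr; auto. }
assert (H3 := eq_trans (eq_sym (is_RInt_unique _ _ _ _ H1))
  (is_RInt_unique _ _ _ _ H2)).
unfold minus, plus, scal, opp, mult in H3; simpl in H3.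
unfold mult in H3; simpl in H3.
lra.
Qed.

(* [Gamma (1 - alpha)] times [I^(1-alpha) g], if [g] vanishes on [s <= 0] and
   [t <= rho beta q]. *)
Definition frac (beta q : R) (g : R -> R) (t : R) : R :=
  beta * RInt (fun r => g (t - rho beta r)) 0 q.

(* The integral of [dg (tau) (t - tau)^(-alpha)] over [0 < tau < t], integrated
   by parts on [0 < tau < t - rho beta b] because the derivative [dg] of [g]
   need not be bounded near [0]. *)
Definition frac_deriv (beta q b : R) (g dg : R -> R) (t : R) : R :=
  g (t - rho beta b) * Rpower b (1 - beta) -
  (beta - 1) * RInt (fun r => g (t - rho beta r) * Rpower r (- beta)) b q +
  beta * RInt (fun r => dg (t - rho beta r)) 0 b.

Lemma continuous_affine_rho (beta : R) (q : R * R) :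
  0 < beta -> continuous (fun q : R * R => fst q - rho beta (snd q)) q.
Proof.
intros Hb; apply @continuous_minus; [apply continuous_fst | ].
apply (continuous_comp snd (rho beta)).
apply continuous_snd. now apply continuous_rho.
Qed.

Lemma RInt_eq0 (g : R -> R) (a b : R) :
  a <= b -> (forall x, a < x < b -> g x = 0) -> RInt g a b = 0.
Proof.
intros Hab Hg; rewrite (RInt_ext _ (fun _ => 0)).
- rewrite RInt_const; apply Rmult_0_r.
- intros x; rewrite Rmin_left, Rmax_right by easy; apply Hg.
Qed.

Lemma RInt_split (g : R -> R) (a b c : R) :
  ex_RInt g a b -> ex_RInt g b c -> RInt g a c = RInt g a b + RInt g b c.
Proof. intros; symmetry; now apply (RInt_Chasles g a b c). Qed.

Lemma RInt_nonpos_0 (g : R -> R) (t : R) :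
  (forall s, s <= 0 -> g s = 0) -> t <= 0 -> RInt g 0 t = 0.
Proof.
intros Hg Ht.
rewrite (RInt_ext _ (fun _ => 0)).
- rewrite RInt_const; unfold scal; simpl; unfold mult; simpl; ring.
- intros x; rewrite Rmin_right, Rmax_left by lra; intros; apply Hg; lra.
Qed.

(** Here the Caputo derivative becomes the time derivative of a continuous function. The cut at [b]
    separates the recent past, at times at least [t - rho beta b > 0] where [dg] is continuous, from
    the remote past, where only [g] may be used. *)
Lemma is_derive_frac (beta q b T : R) (g dg : R -> R) (t : R) :
  0 < beta -> rho beta q = T -> 0 < b < q ->
  (forall s, continuous g s) -> (forall s, s <= 0 -> g s = 0) ->
  (forall s, 0 < s < T -> is_derive g s (dg s) /\ continuous dg s) ->
  rho beta b < t < T ->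
  is_derive (frac beta q g) t (frac_deriv beta q b g dg t).
Proof.
intros Hb HT Hbq Hg Hg0 Hdg Ht.
(* By parts, [g] is traded for its [C^1] primitive [U] away from [r = 0], so that
   differentiation under the integral sign never meets [dg] near [0]. *)
set (U := (fun t => RInt g 0 t) : R -> R).
assert (HU : forall s, is_derive U s (g s)).
{ intros s; now apply is_derive_prim. }
assert (HcU : forall s, continuous U s).
{ intros s; eapply is_derive_continuous, HU. }
apply (is_derive_ext_loc (fun s =>
  beta * RInt (fun r => g (s - rho beta r)) 0 b +
  (U (s - rho beta b) * Rpower b (1 - beta) -
  (beta - 1) * RInt (fun r => U (s - rho beta r) * Rpower r (- beta)) b q))).
{ generalize (locally_lt T t (proj2 Ht)); apply filter_imp; intros s Hs.
  unfold frac.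
  rewrite <- (RInt_Chasles _ 0 b q);
    try (apply ex_RInt_cont; intros; now apply continuous_shift_rho).
  change plus with Rplus; rewrite Rmult_plus_distr_l; f_equal.
  rewrite (RInt_rho_by_parts beta U g s b q); try lra.
  2: { intros r _; split; [apply HU | apply Hg]. }
  (* At [r = q] the argument is [s - T < 0], where [U] vanishes, so the boundary term at [q]
     disappears. This is why [s] is kept below [T]. *)
  rewrite HT; replace (U (s - T)) with 0; [ring | ].
  symmetry; apply RInt_nonpos_0; [easy | lra]. }
replace (frac_deriv beta q b g dg t) with
  (beta * RInt (fun r => dg (t - rho beta r)) 0 b +
   (g (t - rho beta b) * Rpower b (1 - beta) -
  (beta - 1) * RInt (fun r => g (t - rho beta r) * Rpower r (- beta)) b q)).
2: { unfold frac_deriv; ring. }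
apply @is_derive_plus; [ | apply @is_derive_minus].
- apply is_derive_scal.
  destruct (locally_gt _ _ (proj1 Ht)) as [d1 Hd1].
  destruct (locally_lt _ _ (proj2 Ht)) as [d2 Hd2].
  assert (Hin : forall r, r <= b -> 0 < t - rho beta r < T).
  { intros r Hr; pose proof (rho_ge0 beta r).
    pose proof (rho_le beta r b ltac:(lra) Hr); lra. }
  (* The margin of the differentiation lemma allows [r] slightly above [b]. Continuity keeps
     [rho beta r] below the midpoint of [rho beta b] and [t], and [d4] keeps [y] above that
     midpoint, so [y - rho beta r] stays positive. *)
  destruct (continuous_rho beta b Hb (fun z => z < (rho beta b + t) / 2))
    as [d3 Hd3].
  { apply locally_lt; lra. }
  set (d4 := (t - rho beta b) / 2).
  assert (Hd : 0 < Rmin d2 (Rmin d3 d4)).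
  { repeat apply Rmin_pos; try apply cond_pos; unfold d4; lra. }
  pose proof (Rmin_l d2 (Rmin d3 d4)); pose proof (Rmin_r d2 (Rmin d3 d4)).
  pose proof (Rmin_l d3 d4); pose proof (Rmin_r d3 d4).
  apply (is_derive_RInt_param_loc (fun s r => g (s - rho beta r))
    (fun s r => dg (s - rho beta r)) 0 b t (Rmin d2 (Rmin d3 d4))); try lra.
  + intros y r Hy Hr.
    assert (Hin' : 0 < y - rho beta r < T).
    { assert (y < T).
      { apply Hd2; change (Rabs (y - t) < d2); lra. }
      pose proof (rho_ge0 beta r).
      assert (rho beta r < (rho beta b + t) / 2).
      { destruct (Rle_dec r b) as [Hrb | Hrb].
        - pose proof (rho_le beta r b ltac:(lra) Hrb); lra.
        - apply Hd3; change (Rabs (r - b) < d3).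
          rewrite Rabs_pos_eq; lra. }
      apply Rabs_def2 in Hy; unfold d4 in *; lra. }
    replace (dg (y - rho beta r)) with (scal (1 - 0) (dg (y - rho beta r))).
    2: { unfold scal; simpl; unfold mult; simpl; ring. }
    apply (is_derive_comp g (fun s => s - rho beta r)); [now apply Hdg | ].
    apply @is_derive_minus; [apply @is_derive_id | apply @is_derive_const].
  + intros r Hr.
    apply (continuous_comp (fun q : R * R => fst q - rho beta (snd q)) dg).
    * now apply continuous_affine_rho.
    * apply Hdg, Hin; simpl; lra.
  + apply filter_forall; intros s; apply ex_RInt_cont; intros.
    now apply continuous_shift_rho.
- replace (g (t - rho beta b) * Rpower b (1 - beta)) with
    (Rpower b (1 - beta) * (scal (1 - 0) (g (t - rho beta b)))).
  2: { unfold scal; simpl; unfold mult; simpl; ring. }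
  apply (is_derive_ext (fun s => Rpower b (1 - beta) * U (s - rho beta b))).
  { intros; apply Rmult_comm. }
  apply is_derive_scal, (is_derive_comp U (fun s => s - rho beta b)).
  + apply HU.
  + apply @is_derive_minus; [apply @is_derive_id | apply @is_derive_const].
- apply is_derive_scal.
  apply (is_derive_RInt_param_loc
    (fun s r => U (s - rho beta r) * Rpower r (- beta))
    (fun s r => g (s - rho beta r) * Rpower r (- beta)) b q t b); try lra.
  + intros y r _ Hr.
    replace (g (y - rho beta r) * Rpower r (- beta)) with
      (Rpower r (- beta) * (scal (1 - 0) (g (y - rho beta r)))).
    2: { unfold scal; simpl; unfold mult; simpl; ring. }
    apply (is_derive_ext (fun s => Rpower r (- beta) * U (s - rho beta r))).
    { intros; apply Rmult_comm. }
    apply is_derive_scal, (is_derive_comp U (fun s => s - rho beta r)).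
    * apply HU.
    * apply @is_derive_minus; [apply @is_derive_id | apply @is_derive_const].
  + intros r Hr; apply @continuous_mult.
    * apply (continuous_comp (fun q : R * R => fst q - rho beta (snd q)) g).
      now apply continuous_affine_rho. apply Hg.
    * apply (continuous_comp snd (fun r => Rpower r (- beta))).
      apply continuous_snd. apply continuous_Rpower; simpl; lra.
  + apply filter_forall; intros s.
    apply (@ex_RInt_continuous R_CompleteNormedModule); intros r.
    rewrite Rmin_left, Rmax_right by lra; intros Hr.
    apply @continuous_mult; [now apply continuous_shift_rho | ].
    apply continuous_Rpower; lra.
Qed.

(** * The Caputo integral as an improper integral *)

Lemma is_RInt_gen_primitive {Fa Fb : (R -> Prop) -> Prop}
    {FFa : Filter Fa} {FFb : Filter Fb} (f Phi : R -> R) (la lb : R) :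
  filter_prod Fa Fb (fun ab =>
    is_RInt f (fst ab) (snd ab) (Phi (snd ab) - Phi (fst ab))) ->
  filterlim Phi Fa (locally la) -> filterlim Phi Fb (locally lb) ->
  is_RInt_gen f Fa Fb (lb - la).
Proof.
intros HI Ha Hb P HP.
assert (Hlim : filterlim (fun ab : R * R => Phi (snd ab) + opp (Phi (fst ab)))
  (filter_prod Fa Fb) (locally (lb - la))).
{ apply (filterlim_comp_2 (G := locally lb) (H := locally (opp la))).
  - now apply (filterlim_comp _ _ _ snd Phi _ Fb); [apply filterlim_snd | ].
  - apply (filterlim_comp _ _ _ (fun ab => Phi (fst ab)) opp _ (locally la)).
    + now apply (filterlim_comp _ _ _ fst Phi _ Fa); [apply filterlim_fst | ].
    + apply @filterlim_opp.
  - apply @filterlim_plus. }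
apply (filter_imp _ _ (fun ab (H : _ /\ _) =>
  ex_intro _ (Phi (snd ab) + opp (Phi (fst ab))) H)).
apply filter_and; [exact HI | exact (Hlim P HP)].
Qed.

Lemma filterlim_at_right (f : R -> R) (x : R) :
  continuous f x -> filterlim f (at_right x) (locally (f x)).
Proof. apply filterlim_filter_le_1, filter_le_within. Qed.

Lemma filterlim_at_left (f : R -> R) (x : R) :
  continuous f x -> filterlim f (at_left x) (locally (f x)).
Proof. apply filterlim_filter_le_1, filter_le_within. Qed.

Lemma rho_rho (a s : R) : 0 < a -> 0 < s -> rho (/ a) (rho a s) = s.
Proof.
intros Ha Hs.
rewrite (rho_gt0 _ (rho a s)) by now apply rho_pos.
rewrite rho_gt0, Rpower_mult, Rinv_r, Rpower_1; lra.
Qed.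

Lemma rho_lt_inv (beta r s : R) : 0 < beta -> rho beta r < rho beta s -> r < s.
Proof.
intros Hb H; apply Rnot_le_lt; intros Hle.
pose proof (rho_le beta s r Hb Hle); lra.
Qed.

(** The substitution [r = (t - tau)^(1 - alpha)] gives the primitive [Phi] of the integrand on
    [0 < tau < t]. Its limit at [t] is clear, since the singular kernel has been absorbed. Its limit
    at [0] is not, as [dg] may blow up there, and is found after integration by parts, which leaves
    only [g]. *)
Lemma is_RInt_gen_caputo (alpha q b T : R) (g dg : R -> R) (t : R) :
  0 < alpha < 1 -> rho (/ (1 - alpha)) q = T -> 0 < b ->
  (forall s, continuous g s) -> (forall s, s <= 0 -> g s = 0) ->
  (forall s, 0 < s < T -> is_derive g s (dg s) /\ continuous dg s) ->
  rho (/ (1 - alpha)) b < t < T ->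
  is_RInt_gen (fun tau => dg tau / Rpower (t - tau) alpha)
    (at_right 0) (at_left t) (frac_deriv (/ (1 - alpha)) q b g dg t).
Proof.
intros Ha HT Hb0 Hg Hg0 Hdg Ht.
set (beta := / (1 - alpha)) in *.
assert (Hb : 0 < beta) by (apply Rinv_0_lt_compat; lra).
assert (Hba : beta * (1 - alpha) = 1) by (unfold beta; field; lra).
set (rt := (fun tau => rho (1 - alpha) (t - tau)) : R -> R).
assert (Hrho : forall tau, tau < t -> rho beta (rt tau) = t - tau).
{ intros tau Htau; apply rho_rho; lra. }
assert (Hcrt : forall tau, continuous rt tau).
{ intros tau; apply (continuous_comp (fun tau => t - tau) (rho (1 - alpha))).
  - apply @continuous_minus; [apply continuous_const | apply continuous_id].
  - apply continuous_rho; lra. }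
(* In the new variable [tau = t] is [r = 0] and [tau = 0] is [r = p]. Values [p < r < q] correspond
   to negative times, where [g] is zero; hence [I p = I q] below. *)
set (p := rt 0).
pose proof (rho_pos beta b Hb0) as Hrb.
assert (Hp : rho beta p = t).
{ unfold p; rewrite Hrho; lra. }
assert (Hbp : b < p) by (apply (rho_lt_inv beta); lra).
assert (Hpq : p < q) by (apply (rho_lt_inv beta); lra).
assert (Hdgc : forall r, r < p -> continuous (fun r => dg (t - rho beta r)) r).
{ intros r Hr; apply continuous_shift_rho; trivial; apply Hdg.
  pose proof (rho_ge0 beta r).
  destruct (Rle_dec r 0) as [Hr0 | Hr0].
  - rewrite rho_le0 by easy; lra.
  - pose proof (rho_lt beta r p Hb ltac:(lra)); lra. }
assert (Hex : forall x y, x < p -> y < p ->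
  ex_RInt (fun r => dg (t - rho beta r)) x y).
{ intros x y Hx Hy; apply (@ex_RInt_continuous R_CompleteNormedModule).
  intros z Hz; apply Hdgc.
  apply Rle_lt_trans with (1 := proj2 Hz), Rmax_case; lra. }
set (J := (fun z => RInt (fun r => dg (t - rho beta r)) b z) : R -> R).
set (Phi := (fun tau => - beta * J (rt tau)) : R -> R).
set (L := g (t - rho beta b) * Rpower b (1 - beta) -
  (beta - 1) * RInt (fun r => g (t - rho beta r) * Rpower r (- beta)) b q).
assert (HL : filterlim Phi (at_right 0) (locally (- L))).
{ set (I := (fun z =>
    RInt (fun r => g (t - rho beta r) * Rpower r (- beta)) b z) : R -> R).
  assert (Hcg : forall r, 0 < r ->
    continuous (fun r => g (t - rho beta r) * Rpower r (- beta)) r).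
  { intros r Hr; apply @continuous_mult.
    now apply continuous_shift_rho. now apply continuous_Rpower. }
  assert (Hexg : forall x y, 0 < x -> 0 < y ->
    ex_RInt (fun r => g (t - rho beta r) * Rpower r (- beta)) x y).
  { intros x y Hx Hy; apply (@ex_RInt_continuous R_CompleteNormedModule).
    intros z Hz; apply Hcg.
    apply Rlt_le_trans with (2 := proj1 Hz), Rmin_case; lra. }
  (* [Psi] is the by-parts form of [Phi]. It agrees with [Phi] for small positive [tau] but is
     continuous at [0], so its value there is the limit sought. *)
  set (Psi := (fun tau => - (g (t - rho beta b) * Rpower b (1 - beta) -
    g tau * Rpower (rt tau) (1 - beta) - (beta - 1) * I (rt tau))) : R -> R).
  assert (HI : I p = I q).
  { unfold I; rewrite (RInt_split _ b p q) by (apply Hexg; lra).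
    rewrite (RInt_eq0 _ p q); [symmetry; apply Rplus_0_r | lra | ].
    intros r Hr; rewrite Hg0; [ring | ].
    pose proof (rho_lt beta p r Hb ltac:(lra)); lra. }
  assert (HPsi : Psi 0 = - L :> R).
  { unfold Psi, L; fold p; fold (I q); rewrite HI, (Hg0 0) by lra; ring. }
  rewrite <- HPsi.
  apply (filterlim_ext_loc Psi).
  - exists (mkposreal (t - rho beta b) ltac:(lra)); intros tau Hball Htau.
    change (Rabs (tau - 0) < t - rho beta b) in Hball.
    rewrite Rminus_0_r, Rabs_pos_eq in Hball by lra.
    assert (Hbr : b < rt tau).
    { apply (rho_lt_inv beta); trivial; rewrite Hrho; lra. }
    unfold Psi, Phi, J; rewrite Ropp_mult_distr_l_reverse.
    rewrite (RInt_rho_by_parts beta g dg); try lra.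
    + assert (Htt : t - (t - tau) = tau :> R) by ring.
      rewrite Hrho, Htt by lra; reflexivity.
    + intros r Hr; apply Hdg.
      pose proof (rho_ge0 beta r).
      pose proof (rho_le beta r (rt tau) Hb ltac:(lra)).
      rewrite Hrho in H0; lra.
  - apply filterlim_at_right.
    apply @continuous_opp, @continuous_minus; [apply @continuous_minus | ].
    + apply continuous_const.
    + apply @continuous_mult; [apply Hg | ].
      apply (continuous_comp rt (fun r => Rpower r (1 - beta)));
        [apply Hcrt | apply continuous_Rpower; fold p; lra].
    + apply (continuous_scal_r (beta - 1) (fun tau => I (rt tau))).
      apply (continuous_comp rt I); [apply Hcrt | fold p].
      apply (continuous_RInt_1 (fun r => g (t - rho beta r) * Rpower r (- beta)) b).
      generalize (locally_gt 0 p ltac:(lra)); apply filter_imp; intros z Hz.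
      apply (@RInt_correct R_CompleteNormedModule), Hexg; lra. }
assert (HL0 : filterlim Phi (at_left t) (locally (- beta * J 0))).
{ assert (HPhi : Phi t = - beta * J 0 :> R).
  { unfold Phi, rt; rewrite rho_le0; [easy | lra]. }
  rewrite <- HPhi.
  apply filterlim_at_left, (continuous_scal_r (- beta) (fun tau => J (rt tau))).
  apply (continuous_comp rt J); [apply Hcrt | ].
  unfold rt; rewrite rho_le0 by lra.
  apply (continuous_RInt_1 (fun r => dg (t - rho beta r)) b).
  generalize (locally_lt p 0 ltac:(lra)); apply filter_imp; intros z Hz.
  apply (@RInt_correct R_CompleteNormedModule), Hex; lra. }
replace (frac_deriv beta q b g dg t) with (- beta * J 0 - - L).
2: { unfold frac_deriv, J, L; rewrite <- opp_RInt_swap by (apply Hex; lra).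
     change opp with Ropp; ring. }
apply (is_RInt_gen_primitive _ Phi); trivial.
exists (fun x => 0 < x < t) (fun y => 0 < y < t).
{ exists (mkposreal t ltac:(lra)); intros x Hx Hx0.
  change (Rabs (x - 0) < t) in Hx; apply Rabs_def2 in Hx; lra. }
{ exists (mkposreal t ltac:(lra)); intros x Hx Hx0.
  change (Rabs (x - t) < t) in Hx; apply Rabs_def2 in Hx; lra. }
intros x y Hx Hy; simpl.
assert (Hrtp : forall z, 0 < z < t -> rt z < p).
{ intros z Hz; apply (rho_lt_inv beta); trivial; rewrite Hrho; lra. }
assert (Hin : forall z, Rmin x y <= z <= Rmax x y -> 0 < z < t).
{ intros z; apply Rmin_case; apply Rmax_case; lra. }
assert (HPhi : Phi y - Phi x =
  RInt (fun r => scal (- beta) (dg (t - rho beta r))) (rt x) (rt y) :> R).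
{ pose proof (Hrtp x Hx); pose proof (Hrtp y Hy).
     rewrite (RInt_scal (V := R_CompleteNormedModule)
       (fun r => dg (t - rho beta r))) by (now apply Hex).
     unfold Phi, J; rewrite (RInt_split _ b (rt x) (rt y)).
     - change scal with Rmult; ring.
     - apply Hex; lra.
     - apply Hex; lra. }
rewrite HPhi.
apply (is_RInt_ext (fun z => scal (- (1 - alpha) * Rpower (t - z) (- alpha))
   (scal (- beta) (dg (t - rho beta (rt z)))))).
{ intros z Hz; assert (Hz' := Hin z ltac:(lra)).
  rewrite Hrho by lra; replace (t - (t - z)) with z by ring.
  rewrite Rpower_Ropp; unfold scal; simpl; unfold mult; simpl.
  unfold Rdiv; transitivity ((beta * (1 - alpha)) * (dg z * / Rpower (t - z) alpha));
    [ring | rewrite Hba; ring]. }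
apply (is_RInt_comp (fun r => scal (- beta) (dg (t - rho beta r))) rt).
- intros z Hz; apply @continuous_scal_r, Hdgc, Hrtp, Hin, Hz.
- intros z Hz; assert (Hz' := Hin z Hz); split.
  + apply (is_derive_ext_loc (fun z => Rpower (t - z) (1 - alpha))).
    { generalize (locally_lt t z ltac:(lra)); apply filter_imp; intros v Hv.
      unfold rt; rewrite rho_gt0; [easy | lra]. }
    replace (- (1 - alpha) * Rpower (t - z) (- alpha)) with
      (scal (0 - 1) ((1 - alpha) * Rpower (t - z) (1 - alpha - 1))).
    2: { replace (1 - alpha - 1) with (- alpha) by ring.
         unfold scal; simpl; unfold mult; simpl; ring. }
    apply (is_derive_comp (fun s => Rpower s (1 - alpha)) (fun z => t - z)).
    * apply is_derive_Rpower; lra.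
    * apply @is_derive_minus; [apply @is_derive_const | apply @is_derive_id].
  + apply (continuous_scal_r (- (1 - alpha)) (fun z => Rpower (t - z) (- alpha))).
    apply (continuous_comp (fun z => t - z) (fun s => Rpower s (- alpha))).
    * apply @continuous_minus; [apply continuous_const | apply continuous_id].
    * apply continuous_Rpower; lra.
Qed.

(** * Joint continuity in space and time *)

Lemma continuous2_frac (beta q : R) (u : R -> R -> R) (x t : R) :
  0 < beta -> 0 <= q -> (forall y s, continuous2 u y s) ->
  continuous2 (fun x t => frac beta q (u x) t) x t.
Proof.
intros Hb Hq Hu; apply (continuous_scal_r beta (fun p : R * R =>
  RInt (fun r => u (fst p) (snd p - rho beta r)) 0 q)).
apply (continuous_RInt_param
  (fun (p : R * R) r => u (fst p) (snd p - rho beta r))); trivial.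
- intros r _.
  apply (continuous2_comp u (fun p : R * R * R => fst (fst p))
    (fun p => snd (fst p) - rho beta (snd p))); [apply Hu | | ].
  + apply (continuous_comp fst fst); apply continuous_fst.
  + apply @continuous_minus.
    * apply (continuous_comp fst snd).
      apply continuous_fst. apply continuous_snd.
    * apply (continuous_comp snd (rho beta)).
      apply continuous_snd. now apply continuous_rho.
- apply filter_forall; intros p; apply ex_RInt_cont; intros r.
  apply (continuous_shift_rho beta (u (fst p)) (snd p)); trivial.
  apply continuous2_r, Hu.
Qed.

(** Through the equation this yields joint continuity of the third space derivative in the interior,
    which is what permits moving it under the time integral. *)
Lemma continuous2_frac_deriv (beta q b T : R) (u ut : R -> R -> R) (x t : R) :
  0 < beta -> 0 < b < q -> (forall y s, continuous2 u y s) ->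
  (forall y s, 0 < y < 1 -> 0 < s < T -> continuous2 ut y s) ->
  0 < x < 1 -> rho beta b < t < T ->
  continuous2 (fun x t => frac_deriv beta q b (u x) (ut x) t) x t.
Proof.
intros Hb Hbq Hu Hut Hx Ht.
assert (Hc1 : forall p : R * R * R, continuous (fun p : R * R * R =>
  fst (fst p)) p).
{ intros p; apply (continuous_comp fst fst); apply continuous_fst. }
assert (Hc2 : forall p : R * R * R, continuous (fun p : R * R * R =>
  snd (fst p) - rho beta (snd p)) p).
{ intros p; apply @continuous_minus.
  - apply (continuous_comp fst snd).
    apply continuous_fst. apply continuous_snd.
  - apply (continuous_comp snd (rho beta)).
    apply continuous_snd. now apply continuous_rho. }
assert (Hin : forall s r, rho beta b < s < T -> r <= b ->
  0 < s - rho beta r < T).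
{ intros s r Hs Hr; pose proof (rho_ge0 beta r).
  pose proof (rho_le beta r b Hb Hr); lra. }
unfold continuous2, frac_deriv.
apply @continuous_plus; [apply @continuous_minus | ].
- apply @continuous_mult; [ | apply continuous_const].
  apply (continuous2_comp u (fun p : R * R => fst p)
    (fun p => snd p - rho beta b)); [apply Hu | apply continuous_fst | ].
  apply @continuous_minus; [apply continuous_snd | apply continuous_const].
- apply (continuous_scal_r (beta - 1) (fun p : R * R =>
    RInt (fun r => u (fst p) (snd p - rho beta r) * Rpower r (- beta)) b q)).
  apply (continuous_RInt_param (fun (p : R * R) r =>
    u (fst p) (snd p - rho beta r) * Rpower r (- beta))); [lra | | ].
  + intros r Hr; apply @continuous_mult.
    * now apply (continuous2_comp u (fun p : R * R * R => fst (fst p))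
        (fun p => snd (fst p) - rho beta (snd p))).
    * apply (continuous_comp snd (fun r => Rpower r (- beta))).
      apply continuous_snd. apply continuous_Rpower; simpl; lra.
  + apply filter_forall; intros p.
    apply (@ex_RInt_continuous R_CompleteNormedModule); intros r.
    rewrite Rmin_left, Rmax_right by lra; intros Hr.
    apply @continuous_mult; [ | apply continuous_Rpower; lra].
    apply (continuous_shift_rho beta (u (fst p)) (snd p)); trivial.
    apply continuous2_r, Hu.
- apply (continuous_scal_r beta (fun p : R * R =>
    RInt (fun r => ut (fst p) (snd p - rho beta r)) 0 b)).
  apply (continuous_RInt_param (fun (p : R * R) r =>
    ut (fst p) (snd p - rho beta r))); [lra | | ].
  + intros r Hr.
    apply (continuous2_comp ut (fun p : R * R * R => fst (fst p))
        (fun p => snd (fst p) - rho beta (snd p))); trivial.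
    simpl; apply Hut; trivial; apply Hin; lra.
  + assert (Hloc : locally (x, t) (fun p : R * R =>
      0 < fst p < 1 /\ rho beta b < snd p < T)).
    { apply filter_and.
      - apply (continuous_fst x t (fun y => 0 < y < 1)), filter_and.
        now apply locally_gt. now apply locally_lt.
      - apply (continuous_snd x t (fun s => rho beta b < s < T)), filter_and.
        now apply locally_gt. now apply locally_lt. }
    generalize Hloc; apply filter_imp; intros p [Hp1 Hp2].
    apply (@ex_RInt_continuous R_CompleteNormedModule); intros r.
    rewrite Rmin_left, Rmax_right by lra; intros Hr.
    apply (continuous_shift_rho beta (ut (fst p)) (snd p)); trivial.
    apply continuous2_r, Hut; trivial; apply Hin; trivial; lra.
Qed.

(** * Positivity of the Gamma function *)

Lemma filterlim_monotone_bounded (F : (R -> Prop) -> Prop) {FF : Filter F}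
    (D : R -> Prop) (Phi : R -> R) (M : R) :
  (exists x, D x) -> (forall x, D x -> Phi x <= M) ->
  (forall x0, D x0 -> F (fun x => D x /\ Phi x0 <= Phi x)) ->
  exists l, filterlim Phi F (locally l) /\ forall x, D x -> Phi x <= l.
Proof.
intros [x1 Hx1] HM Hmon.
destruct (completeness (fun y => exists x, D x /\ y = Phi x)) as [l [Hub Hlub]].
{ exists M; intros y [x [Hx ->]]; now apply HM. }
{ now exists (Phi x1), x1. }
assert (Hl : forall x, D x -> Phi x <= l).
{ intros x Hx; apply Hub; now exists x. }
exists l; split; [ | exact Hl].
apply filterlim_locally; intros eps.
assert (Hx0 : exists x0, D x0 /\ l - eps < Phi x0).
{ apply Classical_Prop.NNPP; intros Hne.
  assert (Hle : l <= l - eps).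
  { apply Hlub; intros y [x [Hx ->]]; apply Rnot_lt_le; intros Hlt.
    apply Hne; now exists x. }
  pose proof (cond_pos eps); lra. }
destruct Hx0 as [x0 [Hx0 Hlt]].
generalize (Hmon x0 Hx0); apply filter_imp; intros x [Hx Hle].
change (Rabs (Phi x - l) < eps).
pose proof (Hl x Hx); pose proof (cond_pos eps); apply Rabs_def1; lra.
Qed.

Lemma RInt_primitive (f df : R -> R) (a b : R) :
  a <= b -> (forall x, a <= x <= b -> is_derive f x (df x)) ->
  (forall x, a <= x <= b -> continuous df x) ->
  ex_RInt df a b /\ RInt df a b = f b - f a.
Proof.
intros Hab Hd Hc.
assert (HI : is_RInt df a b (f b - f a)).
{ apply (is_RInt_derive f); intros x; rewrite Rmin_left, Rmax_right; auto. }
split; [now eexists; apply HI | exact (is_RInt_unique _ _ _ _ HI)].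
Qed.

(** [RInt_gen] is a total operator, so a sign says nothing before convergence is established. The
    primitive [Phi] is increasing, and each end has an integrable majorant: [exp (- s)] for
    [s >= 1], where [Rpower s (z - 1) <= 1], and [Rpower s (z - 1)] for [s <= 1]. *)
Lemma Gamma_gt0 (z : R) : 0 < z < 1 -> 0 < Gamma z.
Proof.
intros Hz.
set (f := (fun s => Rpower s (z - 1) * exp (- s)) : R -> R).
assert (Hexp : forall s, continuous (fun s => exp (- s)) s).
{ intros s; apply (continuous_comp Ropp exp).
  - apply @continuous_opp, continuous_id.
  - apply continuity_pt_filterlim, derivable_continuous_pt, derivable_pt_exp. }
assert (Hf : forall s, 0 < s -> continuous f s).
{ intros s Hs; apply @continuous_mult; [now apply continuous_Rpower | apply Hexp]. }
assert (Hf0 : forall s, 0 < f s).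
{ intros s; apply Rmult_lt_0_compat; [apply Rpower_gt0 | apply exp_pos]. }
assert (Hex : forall x y, 0 < x -> 0 < y -> ex_RInt f x y).
{ intros x y Hx Hy; apply (@ex_RInt_continuous R_CompleteNormedModule).
  intros s [Hs _]; apply Hf.
  apply Rlt_le_trans with (2 := Hs), Rmin_case; lra. }
set (Phi := (fun x => RInt f 1 x) : R -> R).
assert (Hsplit : forall x y, 0 < x -> 0 < y -> Phi y = Phi x + RInt f x y).
{ intros x y Hx Hy; apply RInt_split; apply Hex; lra. }
assert (Hlt : forall x y, 0 < x < y -> Phi x < Phi y).
{ intros x y Hxy; rewrite (Hsplit x y) by lra.
  pose proof (RInt_gt_0 f x y (proj2 Hxy) (fun s _ => Hf0 s)
    (fun s Hs => Hf s (Rlt_le_trans _ _ _ (proj1 Hxy) (proj1 Hs)))); lra. }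
assert (HPhi1 : Phi 1 = 0) by (apply (@RInt_point R_CompleteNormedModule)).
destruct (filterlim_monotone_bounded (Rbar_locally p_infty) (fun x => 1 < x)
  Phi 1) as [lb [Hlb Hb]].
{ exists 2; lra. }
{ intros x Hx.
  destruct (RInt_primitive (fun s => - exp (- s)) (fun s => exp (- s)) 1 x)
    as [HE1 HE2]; [lra | | now intros | ].
  { intros s _; auto_derive; [easy | ring]. }
  apply Rle_trans with (RInt (fun s => exp (- s)) 1 x).
  - apply RInt_le; [lra | apply Hex; lra | exact HE1 | ].
    intros s Hs; unfold f; rewrite <- (Rmult_1_l (exp (- s))) at 2.
    apply Rmult_le_compat_r; [apply Rlt_le, exp_pos | ].
    apply Rle_trans with (Rpower s 0); [apply Rle_Rpower; lra | ].
    rewrite Rpower_O; lra.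
  - rewrite HE2; cbv beta; pose proof (exp_pos (- x)).
    pose proof (exp_increasing (Ropp 1) 0 ltac:(lra)) as Hlt1.
    rewrite exp_0 in Hlt1; lra. }
{ intros x0 Hx0; exists x0; intros x Hx; split; [lra | ].
  apply Rlt_le, Hlt; lra. }
(* The bound [/ z] is the integral of [s^(z - 1)] over [0 < s < 1]. The sign is changed because
   [Phi] decreases as its argument tends to [0]. *)
destruct (filterlim_monotone_bounded (at_right 0) (fun x => 0 < x < 1)
  (fun x => - Phi x) (/ z)) as [la [Hla Ha]].
{ exists (1 / 2); lra. }
{ intros x Hx.
  destruct (RInt_primitive (fun s => / z * Rpower s z)
    (fun s => Rpower s (z - 1)) x 1) as [HE1 HE2]; [lra | | | ].
  { intros s Hs.
    replace (Rpower s (z - 1)) with (/ z * (z * Rpower s (z - 1))).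
    - apply is_derive_scal, is_derive_Rpower; lra.
    - field; lra. }
  { intros s Hs; apply continuous_Rpower; lra. }
  pose proof (Hsplit x 1 ltac:(lra) ltac:(lra)) as Hs; rewrite HPhi1 in Hs.
  replace (- Phi x) with (RInt f x 1) by lra.
  apply Rle_trans with (RInt (fun s => Rpower s (z - 1)) x 1).
  - apply RInt_le; [lra | apply Hex; lra | exact HE1 | ].
    intros s Hs1; unfold f; rewrite <- (Rmult_1_r (Rpower s (z - 1))) at 2.
    apply Rmult_le_compat_l; [apply Rlt_le, Rpower_gt0 | ].
    rewrite <- exp_0; apply Rlt_le, exp_increasing; lra.
  - rewrite HE2; cbv beta; assert (0 < / z * Rpower x z).
    { apply Rmult_lt_0_compat; [apply Rinv_0_lt_compat; lra | apply Rpower_gt0]. }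
    replace (Rpower 1 z) with 1; [lra | ].
    unfold Rpower; now rewrite ln_1, Rmult_0_r, exp_0. }
{ intros x0 Hx0; exists (mkposreal x0 (proj1 Hx0)); intros x Hx Hx'.
  change (Rabs (x - 0) < x0) in Hx; apply Rabs_def2 in Hx; split; [lra | ].
  apply Ropp_le_contravar, Rlt_le, Hlt; lra. }
assert (HI : is_RInt_gen f (at_right 0) (Rbar_locally p_infty) (lb - - la)).
{ apply (is_RInt_gen_primitive f Phi); trivial.
  - exists (fun x => 0 < x) (fun x => 0 < x).
    + exists (mkposreal 1 Rlt_0_1); intros x _ Hx; exact Hx.
    + now exists 0.
    + intros x y Hx Hy; simpl.
      assert (Hxy : Phi y - Phi x = RInt f x y).
      { rewrite (Hsplit x y) by easy; ring. }
      rewrite Hxy; now apply (@RInt_correct R_CompleteNormedModule), Hex.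
  - apply (filterlim_ext (fun x => opp (- Phi x))).
    { intros x; apply Ropp_involutive. }
    apply (filterlim_comp _ _ _ (fun x => - Phi x) opp _ (locally la)); trivial.
    apply @filterlim_opp. }
assert (HG : Gamma z = lb - - la) by exact (is_RInt_gen_unique _ _ HI).
rewrite HG.
pose proof (Hb 2 ltac:(lra)); pose proof (Hlt 1 2 ltac:(lra)).
pose proof (Ha (1 / 2) ltac:(lra)); pose proof (Hlt (1 / 2) 1 ltac:(lra)).
lra.
Qed.

(** * The energy inequality in space *)

Lemma eq_of_is_derive (f g df : R -> R) (a b c : R) :
  a < c < b -> f c = g c ->
  (forall x, a < x < b -> is_derive f x (df x) /\ is_derive g x (df x)) ->
  forall x, a < x < b -> f x = g x.
Proof.
intros Hc Hfg Hd x Hx.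
assert (H0 : forall z, a < z < b -> is_derive (fun z => f z - g z) z 0).
{ intros z Hz; replace 0 with (df z - df z) by ring.
  apply (is_derive_minus f g z (df z) (df z)); now apply Hd. }
assert (Hinc : forall y, Rmin c x <= y <= Rmax c x -> a < y < b).
{ intros y; apply Rmin_case; apply Rmax_case; lra. }
destruct (MVT_gen (fun z => f z - g z) c x (fun _ => 0)) as [z [_ Hz]].
- intros y Hy; apply H0, Hinc; lra.
- intros y Hy; apply continuity_pt_filterlim.
  exact (is_derive_continuous _ _ _ (H0 y (Hinc y Hy))).
- lra.
Qed.

Lemma filterlim_unique_R (F : (R -> Prop) -> Prop) {FF : ProperFilter F}
    (f : R -> R) (l l' : R) :
  filterlim f F (locally l) -> filterlim f F (locally l') -> l = l'.
Proof. exact (@filterlim_locally_unique R R_AbsRing R_NormedModule F _ f l l'). Qed.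

Lemma energy_third_derivative_le0 (V V1 V2 k : R -> R) :
  (forall x, 0 < x < 1 ->
     is_derive V x (V1 x) /\ is_derive V1 x (V2 x) /\ is_derive V2 x (k x)) ->
  (forall x, continuous k x) -> continuous V 0 -> continuous V 1 ->
  V 0 = 0 -> V 1 = 0 -> filterlim V1 (at_right 0) (locally 0) ->
  RInt (fun x => V x * k x) 0 1 <= 0.
Proof.
intros Hd Hk HV0 HV1 H0 H1 Hlim.
set (h := 1 / 2).
assert (Hh : 0 < h < 1) by (unfold h; lra).
assert (Hprim : forall (f : R -> R) c, (forall x, continuous f x) ->
  forall x, is_derive (fun x => c + RInt f h x) x (f x)).
{ intros f c Hf x; replace (f x) with (0 + f x) by ring.
  apply @is_derive_plus; [apply @is_derive_const | now apply is_derive_prim]. }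
assert (Hat : forall (f : R -> R) c, c + RInt f h h = c).
{ intros f c; rewrite (RInt_point h f); apply Rplus_0_r. }
(* [V] is not known to be smooth up to the boundary; the iterated primitive [W]
   of [k] is, and it coincides with [V]. *)
set (W2 := (fun x => V2 h + RInt k h x) : R -> R).
assert (HW2 : forall x, is_derive W2 x (k x)) by now apply Hprim.
assert (HcW2 : forall x, continuous W2 x).
{ intros x; eapply is_derive_continuous, HW2. }
set (W1 := (fun x => V1 h + RInt W2 h x) : R -> R).
assert (HW1 : forall x, is_derive W1 x (W2 x)) by now apply Hprim.
assert (HcW1 : forall x, continuous W1 x).
{ intros x; eapply is_derive_continuous, HW1. }
set (W := (fun x => V h + RInt W1 h x) : R -> R).
assert (HW : forall x, is_derive W x (W1 x)) by now apply Hprim.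
assert (HcW : forall x, continuous W x).
{ intros x; eapply is_derive_continuous, HW. }
assert (E2 : forall x, 0 < x < 1 -> W2 x = V2 x).
{ apply (eq_of_is_derive _ _ k 0 1 h); trivial; [apply Hat | ].
  intros x Hx; split; [apply HW2 | apply Hd, Hx]. }
assert (E1 : forall x, 0 < x < 1 -> W1 x = V1 x).
{ apply (eq_of_is_derive _ _ W2 0 1 h); trivial; [apply Hat | ].
  intros x Hx; split; [apply HW1 | rewrite (E2 x Hx); apply Hd, Hx]. }
assert (E0 : forall x, 0 < x < 1 -> W x = V x).
{ apply (eq_of_is_derive _ _ W1 0 1 h); trivial; [apply Hat | ].
  intros x Hx; split; [apply HW | rewrite (E1 x Hx); apply Hd, Hx]. }
assert (Hr01 : at_right 0 (fun x => 0 < x < 1)).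
{ exists (mkposreal 1 Rlt_0_1); intros x Hx Hx0.
  change (Rabs (x - 0) < 1) in Hx; apply Rabs_def2 in Hx; lra. }
assert (Hl01 : at_left 1 (fun x => 0 < x < 1)).
{ exists (mkposreal 1 Rlt_0_1); intros x Hx Hx0.
  change (Rabs (x - 1) < 1) in Hx; apply Rabs_def2 in Hx; lra. }
assert (W10 : W1 0 = 0).
{ apply (filterlim_unique_R (at_right 0) W1); [now apply filterlim_at_right | ].
  apply (filterlim_ext_loc V1); trivial.
  generalize Hr01; apply filter_imp; intros x Hx; symmetry; now apply E1. }
assert (W00 : W 0 = 0).
{ rewrite <- H0 at 2.
  apply (filterlim_unique_R (at_right 0) W); [now apply filterlim_at_right | ].
  apply (filterlim_ext_loc V); [ | now apply filterlim_at_right].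
  generalize Hr01; apply filter_imp; intros x Hx; symmetry; now apply E0. }
assert (W01 : W 1 = 0).
{ rewrite <- H1.
  apply (filterlim_unique_R (at_left 1) W); [now apply filterlim_at_left | ].
  apply (filterlim_ext_loc V); [ | now apply filterlim_at_left].
  generalize Hl01; apply filter_imp; intros x Hx; symmetry; now apply E0. }
(* A primitive of [W W'''], since the two terms [W' W''] cancel. The boundary values leave [P 0 = 0]
   and [P 1 = - (W1 1)^2 / 2]. *)
set (P := (fun x => W x * W2 x - / 2 * (W1 x * W1 x)) : R -> R).
assert (HP : RInt (fun x => W x * k x) 0 1 = P 1 - P 0).
{ apply RInt_primitive; [lra | | ].
  - intros x _.
    replace (W x * k x) with ((W1 x * W2 x + W x * k x) -
      / 2 * (W2 x * W1 x + W1 x * W2 x)) by field.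
    apply @is_derive_minus; [ | apply is_derive_scal];
      now apply @is_derive_mult; [ | | intros; apply Rmult_comm].
  - intros x _; now apply @continuous_mult. }
rewrite (RInt_ext _ (fun x => W x * k x)).
- rewrite HP; unfold P; rewrite W00, W01, W10; pose proof (Rle_0_sqr (W1 1)); unfold Rsqr in *; lra.
- intros x; rewrite Rmin_left, Rmax_right by lra; intros Hx.
  now rewrite E0.
Qed.

(** * The extremum principle for the Caputo derivative *)

Lemma continuous_bounded (f : R -> R) (a b : R) :
  a <= b -> (forall x, continuous f x) ->
  exists C, 0 < C /\ forall x, a <= x <= b -> Rabs (f x) <= C.
Proof.
intros Hab Hf.
destruct (continuity_ab_maj (fun x => Rabs (f x)) a b Hab) as [m [Hm _]].
{ intros x _; apply continuity_pt_filterlim.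
  apply (continuous_comp f Rabs); [apply Hf | apply continuous_Rabs]. }
exists (Rabs (f m) + 1); split.
- pose proof (Rabs_pos (f m)); lra.
- intros x Hx; pose proof (Hm x Hx); lra.
Qed.

(** Integrated by parts, the Caputo derivative at [t] is, up to positive factors,
    [phi t * t^(-alpha)] plus an integral of [phi t - phi s] against the positive kernel
    [(t - s)^(-alpha - 1)]. At a positive maximum the first term is positive and the second
    nonnegative. *)
Lemma frac_max_gt0 (beta q t : R) (phi dphi : R -> R) :
  1 <= beta -> 0 < t <= rho beta q ->
  (forall s, is_derive phi s (dphi s)) -> (forall s, continuous dphi s) ->
  (forall s, s <= 0 -> phi s = 0) -> (forall s, s <= t -> phi s <= phi t) ->
  0 < phi t -> 0 < frac beta q dphi t.
Proof.
intros Hb [Ht Htq] Hd Hc H0 Hmax Hpos.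
destruct (continuous_bounded dphi 0 t ltac:(lra) Hc) as [C [HC HCb]].
assert (Hq : 0 < q).
{ apply Rnot_le_lt; intros Hq; rewrite (rho_le0 _ q) in Htq; lra. }
set (M := phi t) in *.
set (kappa := M * Rpower q (1 - beta)).
assert (Hk : 0 < kappa) by (apply Rmult_lt_0_compat; [easy | apply Rpower_gt0]).
(* The integral over [0 < r < b] and the boundary term at [b] are [O(b)], the
   boundary term at [q] is [kappa] independently of [b], and the remaining
   integral has the right sign. *)
set (b := Rmin (rho (/ beta) t) (Rmin q (kappa / (2 * C * (1 + beta))))).
assert (Hden : 0 < 2 * C * (1 + beta)) by (repeat apply Rmult_lt_0_compat; lra).
assert (Hb0 : 0 < b).
{ repeat apply Rmin_pos; trivial; [now apply rho_pos | ].
  now apply Rdiv_lt_0_compat. }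
assert (Hb1 : b <= rho (/ beta) t) by apply Rmin_l.
assert (Hb2 : b <= q) by (eapply Rle_trans; [apply Rmin_r | apply Rmin_l]).
assert (Hb3 : b * (2 * C * (1 + beta)) <= kappa).
{ apply Rle_div_r; trivial.
  eapply Rle_trans; [apply Rmin_r | apply Rmin_r]. }
assert (Hrb : rho beta b <= t).
{ rewrite <- (rho_rho (/ beta) t) by (trivial; apply Rinv_0_lt_compat; lra).
  rewrite Rinv_inv; apply rho_le; lra. }
assert (Hex : forall x y, ex_RInt (fun r => dphi (t - rho beta r)) x y).
{ intros x y; apply ex_RInt_cont; intros r; apply continuous_shift_rho;
    [lra | apply Hc]. }
unfold frac; rewrite (RInt_split _ 0 b q), Rmult_plus_distr_l by easy.
(* The primitive [phi - M] is chosen instead of [phi]: it has a constant sign on the past, and it is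
   small near the present, where the weight is large. *)
rewrite (RInt_rho_by_parts beta (fun s => phi s - M) dphi t b q); try lra.
2: { intros r _; split; [ | apply Hc].
     replace (dphi (t - rho beta r)) with (dphi (t - rho beta r) - 0) by ring.
     apply @is_derive_minus; [apply Hd | apply @is_derive_const]. }
rewrite (H0 (t - rho beta q)) by lra.
assert (Hfirst : - (b * C) <= RInt (fun r => dphi (t - rho beta r)) 0 b).
{ assert (Habs : Rabs (RInt (fun r => dphi (t - rho beta r)) 0 b) <= (b - 0) * C).
  { apply abs_RInt_le_const; [lra | apply Hex | ].
    intros r Hr; apply HCb; pose proof (rho_ge0 beta r).
    pose proof (rho_le beta r b ltac:(lra) (proj2 Hr)); lra. }
  rewrite Rminus_0_r in Habs; apply Rabs_le_between in Habs; lra. }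
(* By the mean value theorem [phi - M] is [O(rho beta b)], which compensates the weight:
   [rho beta b * Rpower b (1 - beta) = b]. *)
assert (Hsecond : - C * b <= (phi (t - rho beta b) - M) * Rpower b (1 - beta)).
{ assert (Hmv : - C * rho beta b <= phi (t - rho beta b) - M).
  { pose proof (rho_pos beta b Hb0).
    destruct (MVT_gen phi (t - rho beta b) t dphi) as [c [Hcc Hceq]].
    - intros; apply Hd.
    - intros x _; apply continuity_pt_filterlim.
      exact (is_derive_continuous _ _ _ (Hd x)).
    - rewrite Rmin_left, Rmax_right in Hcc by lra.
      pose proof (HCb c ltac:(lra)) as Hbd; apply Rabs_le_between in Hbd.
      fold M in Hceq; nra. }
  replace (- C * b) with (- C * rho beta b * Rpower b (1 - beta)).
  - apply Rmult_le_compat_r; [apply Rlt_le, Rpower_gt0 | easy].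
  - rewrite rho_gt0, Rmult_assoc, <- Rpower_plus by easy.
    replace (beta + (1 - beta)) with 1 by ring; now rewrite Rpower_1. }
assert (Hthird : RInt (fun r => (phi (t - rho beta r) - M) * Rpower r (- beta)) b q
  <= 0).
{ rewrite <- (RInt_eq0 (fun _ => 0) b q) by (easy || lra).
  apply RInt_le; trivial.
  - apply (@ex_RInt_continuous R_CompleteNormedModule); intros r.
    rewrite Rmin_left, Rmax_right by lra; intros Hr.
    apply @continuous_mult; [ | apply continuous_Rpower; lra].
    apply @continuous_minus; [ | apply continuous_const].
    apply continuous_shift_rho; [lra | ].
    eapply is_derive_continuous, Hd.
  - apply ex_RInt_cont; intros; apply continuous_const.
  - intros r Hr; pose proof (Hmax (t - rho beta r)).
    pose proof (rho_ge0 beta r); pose proof (Rpower_gt0 r (- beta)).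
    assert (phi (t - rho beta r) <= M) by (apply Hmax; lra).
    nra. }
assert (0 < C * b) by now apply Rmult_lt_0_compat.
fold kappa; unfold kappa in *; nra.
Qed.

(** * The homogeneous problem *)

Lemma RInt_ext_R (f g : R -> R) (a b : R) :
  (forall x : R, f x = g x :> R) -> RInt f a b = RInt g a b :> R.
Proof. intros H; apply RInt_ext; intros; apply H. Qed.

Lemma RInt_scal_R (f : R -> R) (c a b : R) :
  ex_RInt f a b -> RInt (fun x => c * f x) a b = c * RInt f a b :> R.
Proof. intros H; exact (RInt_scal (V := R_CompleteNormedModule) f a b c H). Qed.

Lemma RInt_nonneg_eq0 (f : R -> R) (a b : R) :
  (forall x, continuous f x) -> (forall x, 0 <= f x) -> RInt f a b <= 0 ->
  forall x, a < x < b -> f x = 0.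
Proof.
intros Hc Hp Hle x Hx.
assert (Hge : forall y z, y <= z -> 0 <= RInt f y z).
{ intros y z Hyz; apply RInt_ge_0; trivial; now apply ex_RInt_cont. }
assert (H0 : forall y, a < y < b -> RInt f a y = 0).
{ intros y Hy; rewrite (RInt_split f a y b) in Hle by now apply ex_RInt_cont.
  pose proof (Hge a y ltac:(lra)); pose proof (Hge y b ltac:(lra)); lra. }
rewrite <- (is_derive_unique _ _ _ (is_derive_prim f a x Hc)).
apply is_derive_unique, (is_derive_ext_loc (fun _ => 0)).
- generalize (filter_and _ _ (locally_gt a x (proj1 Hx))
    (locally_lt b x (proj2 Hx))); apply filter_imp; intros y Hy.
  symmetry; now apply H0.
- apply @is_derive_const.
Qed.

(** Rescaling the integration variable by [t] moves the variable endpoint into the integrand; the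
    interval becomes [[0, 1]] whatever the sign of [t]. *)
Lemma continuous2_primitive (u : R -> R -> R) (x t : R) :
  (forall y s, continuous2 u y s) ->
  continuous2 (fun x t => RInt (u x) 0 t) x t.
Proof.
intros Hu.
apply (continuous_ext (fun p : R * R =>
  RInt (fun s => snd p * u (fst p) (snd p * s)) 0 1)).
{ intros [y r]; simpl.
  rewrite <- (RInt_ext (fun s => scal r (u y (r * s + 0)))).
  - rewrite (RInt_comp_lin (V := R_CompleteNormedModule) (u y) r 0).
    + f_equal; ring.
    + apply ex_RInt_cont; intros s; apply continuous2_r, Hu.
  - intros s _; now rewrite Rplus_0_r. }
assert (Hc : forall p : R * R * R, continuous (fun p : R * R * R =>
    snd (fst p) * u (fst (fst p)) (snd (fst p) * snd p)) p).
{ intros p.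
  assert (H2 : continuous (fun p : R * R * R => snd (fst p)) p).
  { apply (continuous_comp fst snd).
    apply continuous_fst. apply continuous_snd. }
  apply @continuous_mult; trivial.
  apply (continuous2_comp u (fun p : R * R * R => fst (fst p))
    (fun p => snd (fst p) * snd p)); [apply Hu | | ].
  - apply (continuous_comp fst fst); apply continuous_fst.
  - apply @continuous_mult; [trivial | apply continuous_snd]. }
apply (continuous_RInt_param
  (fun (p : R * R) s => snd p * u (fst p) (snd p * s))); [lra | | ].
- intros s _; apply Hc.
- apply filter_forall; intros p; apply ex_RInt_cont; intros s.
  apply (continuous_comp_2 (fun _ : R => p) (fun s => s)
    (fun (p : R * R) s => snd p * u (fst p) (snd p * s))).
  + apply continuous_const.
  + apply continuous_id.
  + apply Hc.
Qed.

(** The constant [c] stands for [Gamma (1 - alpha)], which [frac] leaves out: the time-integrated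
    equation reads [V''' = (K x t - K x e) / c], and [c > 0] does not affect the sign. *)
Lemma energy_increment_le0 (alpha T c : R) (u ux uxx uxxx ut : R -> R -> R)
    (e t : R) :
  0 < alpha < 1 -> 0 < c -> 0 < e < t -> t < T ->
  (forall x t, continuous2 u x t) -> (forall x t, t <= 0 -> u x t = 0) ->
  (forall t, u 0 t = 0) -> (forall t, u 1 t = 0) ->
  (forall x t, 0 < x < 1 -> 0 < t < T ->
     is_derive (fun y => u y t) x (ux x t) /\
     is_derive (fun y => ux y t) x (uxx x t) /\
     is_derive (fun y => uxx y t) x (uxxx x t) /\
     is_derive (u x) t (ut x t)) ->
  (forall x t, 0 < x < 1 -> 0 < t < T ->
     continuous2 ux x t /\ continuous2 uxx x t /\ continuous2 ut x t) ->
  (forall x t, 0 < x < 1 -> 0 < t < T ->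
     is_RInt_gen (fun tau => ut x tau / Rpower (t - tau) alpha)
       (at_right 0) (at_left t) (c * uxxx x t)) ->
  filterlim (fun x => RInt (ux x) e t) (at_right 0) (locally 0) ->
  let K x s := frac (/ (1 - alpha)) (rho (1 - alpha) T) (u x) s in
  RInt (fun x => (RInt (u x) 0 t - RInt (u x) 0 e) * (K x t - K x e)) 0 1 <= 0.
Proof.
intros Ha Hc0 He Ht Hu Hu0 HuL HuR Hd Hc Heq Hlim K.
set (beta := / (1 - alpha)) in *; set (q := rho (1 - alpha) T) in *.
assert (Hb : 0 < beta) by (apply Rinv_0_lt_compat; lra).
assert (HqT : rho beta q = T) by (apply rho_rho; lra).
(* With [rho beta b = e / 2] the formula for the Caputo derivative holds for all times in
   [(e / 2, T)], an open interval around [[e, t]], with one and the same [b]. *)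
set (b := rho (1 - alpha) (e / 2)).
assert (Hbe : rho beta b = e / 2) by (apply rho_rho; lra).
assert (Hb0 : 0 < b) by (apply rho_pos; lra).
assert (Hbq : b < q) by (apply (rho_lt_inv beta); lra).
(* The third space derivative as prescribed by the equation; unlike [uxxx], its joint continuity can
   be proved. *)
set (W3 := fun x s => frac_deriv beta q b (u x) (ut x) s / c).
assert (Hur : forall x s, continuous (u x) s).
{ intros; apply continuous2_r, Hu. }
assert (HW3 : forall x s, 0 < x < 1 -> e / 2 < s < T -> uxxx x s = W3 x s).
{ intros x s Hx Hs.
  assert (HI : is_RInt_gen (fun tau => ut x tau / Rpower (s - tau) alpha)
    (at_right 0) (at_left s) (frac_deriv beta q b (u x) (ut x) s)).
  { apply (is_RInt_gen_caputo alpha q b T (u x) (ut x) s); trivial.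
    - intros; now apply Hu0.
    - intros r Hr; split; [now apply Hd | ].
      apply continuous2_r; now apply Hc.
    - fold beta; rewrite Hbe; lra. }
  pose proof (Heq x s Hx ltac:(lra)) as HI'.
  assert (H12 : frac_deriv beta q b (u x) (ut x) s = c * uxxx x s).
  { rewrite <- (is_RInt_gen_unique _ _ HI); exact (is_RInt_gen_unique _ _ HI'). }
  unfold W3; rewrite H12; field; lra. }
assert (HW3c : forall x s, 0 < x < 1 -> e / 2 < s < T -> continuous2 W3 x s).
{ intros x s Hx Hs; apply @continuous_mult; [ | apply continuous_const].
  apply (continuous2_frac_deriv beta q b T); trivial; try lra.
  intros y r Hy Hr; now apply Hc. }
assert (HcK : forall x s, continuous2 K x s).
{ intros x s; apply continuous2_frac; trivial; lra. }
assert (Hleib : forall f df : R -> R -> R,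
  (forall x s, 0 < x < 1 -> e / 2 < s < T ->
     is_derive (fun y => f y s) x (df x s) /\ continuous2 df x s) ->
  (forall x s, 0 < x < 1 -> e / 2 < s < T -> continuous (f x) s) ->
  forall x, 0 < x < 1 ->
    is_derive (fun x => RInt (f x) e t) x (RInt (df x) e t)).
{ intros f df Hf Hcf x Hx.
  (* The four terms keep the rectangle around [{x} * [e, t]] inside [(0, 1) * (e / 2, T)]. *)
  set (d := Rmin (Rmin x (1 - x)) (Rmin (e / 2) (T - t))).
  assert (Hdpos : 0 < d) by (repeat apply Rmin_pos; lra).
  assert (Hd1 : d <= x) by (eapply Rle_trans; apply Rmin_l).
  assert (Hd2 : d <= 1 - x) by (eapply Rle_trans; [apply Rmin_l | apply Rmin_r]).
  assert (Hd3 : d <= e / 2) by (eapply Rle_trans; [apply Rmin_r | apply Rmin_l]).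
  assert (Hd4 : d <= T - t) by (eapply Rle_trans; apply Rmin_r).
  apply (is_derive_RInt_param_loc f df e t x d); trivial; try lra.
  - intros y r Hy Hr; apply Rabs_def2 in Hy; apply Hf; lra.
  - intros r Hr; apply Hf; lra.
  - generalize (filter_and _ _ (locally_gt 0 x (proj1 Hx))
      (locally_lt 1 x (proj2 Hx))); apply filter_imp; intros y Hy.
    apply (@ex_RInt_continuous R_CompleteNormedModule); intros r.
    rewrite Rmin_left, Rmax_right by lra; intros Hr; apply Hcf; lra. }
assert (HV : forall x, RInt (u x) 0 t - RInt (u x) 0 e = RInt (u x) e t).
{ intros x; rewrite (RInt_split (u x) 0 e t) by (now apply ex_RInt_cont); ring. }
assert (Hk : forall x, 0 < x < 1 -> (K x t - K x e) / c = RInt (W3 x) e t).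
{ intros x Hx.
  destruct (RInt_primitive (fun s => / c * K x s) (W3 x) e t) as [_ HI].
  - lra.
  - intros s Hs; unfold W3, Rdiv; rewrite Rmult_comm.
    apply is_derive_scal, (is_derive_frac beta q b T); trivial; try lra.
    + intros; now apply Hu0.
    + intros r Hr; split; [now apply Hd | ].
      apply continuous2_r; now apply Hc.
  - intros s Hs; apply continuous2_r, HW3c; lra.
  - rewrite HI; unfold Rdiv; ring. }
assert (HV0 : forall x, continuous (fun x => RInt (u x) e t) x).
{ intros x; apply continuous_RInt_param; [lra | intros; apply Hu | ].
  apply filter_forall; intros y; now apply ex_RInt_cont. }
assert (Hen := energy_third_derivative_le0 (fun x => RInt (u x) e t)
  (fun x => RInt (ux x) e t) (fun x => RInt (uxx x) e t)
  (fun x => (K x t - K x e) / c)).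
rewrite (RInt_ext _ (fun x => scal c
  (RInt (u x) e t * ((K x t - K x e) / c)))).
2: { intros x _; rewrite HV; unfold scal; simpl; unfold mult; simpl.
     field; lra. }
assert (Hkc : forall x, continuous (fun x => (K x t - K x e) / c) x).
{ intros x; apply @continuous_mult; [ | apply continuous_const].
  apply @continuous_minus; apply (continuous2_l K), HcK. }
rewrite (RInt_scal (V := R_CompleteNormedModule)
  (fun x => RInt (u x) e t * ((K x t - K x e) / c))).
2: { apply ex_RInt_cont; intros x; now apply @continuous_mult. }
change scal with Rmult.
enough (RInt (fun x => RInt (u x) e t * ((K x t - K x e) / c)) 0 1 <= 0) by nra.
apply Hen; trivial.
- intros x Hx; split; [ | split].
  + apply Hleib; trivial.
    intros y s Hy Hs; split; [apply Hd | apply Hc]; lra.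
  + apply Hleib; trivial.
    * intros y s Hy Hs; split; [apply Hd | apply Hc]; lra.
    * intros y s Hy Hs; apply continuous2_r, Hc; lra.
  + rewrite Hk by easy; apply Hleib; trivial.
    * intros y s Hy Hs; split; [ | now apply HW3c].
      rewrite <- HW3 by easy; apply Hd; lra.
    * intros y s Hy Hs; apply continuous2_r, Hc; lra.
- apply RInt_eq0; [lra | intros; apply HuL].
- apply RInt_eq0; [lra | intros; apply HuR].
Qed.

Lemma homogeneous_solution_eq0 (alpha T c : R) (u ux uxx uxxx ut : R -> R -> R) :
  0 < alpha < 1 -> 0 < T -> 0 < c ->
  (forall x t, continuous2 u x t) -> (forall x t, t <= 0 -> u x t = 0) ->
  (forall t, u 0 t = 0) -> (forall t, u 1 t = 0) ->
  (forall x t, 0 < x < 1 -> 0 < t < T ->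
     is_derive (fun y => u y t) x (ux x t) /\
     is_derive (fun y => ux y t) x (uxx x t) /\
     is_derive (fun y => uxx y t) x (uxxx x t) /\
     is_derive (u x) t (ut x t)) ->
  (forall x t, 0 < x < 1 -> 0 < t < T ->
     continuous2 ux x t /\ continuous2 uxx x t /\ continuous2 ut x t) ->
  (forall x t, 0 < x < 1 -> 0 < t < T ->
     is_RInt_gen (fun tau => ut x tau / Rpower (t - tau) alpha)
       (at_right 0) (at_left t) (c * uxxx x t)) ->
  (forall e t, 0 < e < t -> t < T ->
     filterlim (fun x => RInt (ux x) e t) (at_right 0) (locally 0)) ->
  forall x t, 0 <= x <= 1 -> t < T -> u x t = 0.
Proof.
intros Ha HT Hc0 Hu Hu0 HuL HuR Hd Hc Heq Hlim.
set (beta := / (1 - alpha)); set (q := rho (1 - alpha) T).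
assert (Hb1 : 1 <= beta).
{ unfold beta; rewrite <- Rinv_1 at 1; apply Rinv_le_contravar; lra. }
assert (HqT : rho beta q = T) by (apply rho_rho; lra).
assert (Hq : 0 < q) by (apply rho_pos; lra).
set (U := (fun x t => RInt (u x) 0 t) : R -> R -> R).
set (K := (fun x t => frac beta q (u x) t) : R -> R -> R).
assert (Hur : forall x s, continuous (u x) s).
{ intros; apply continuous2_r, Hu. }
assert (HUc : forall x t, continuous2 U x t).
{ intros; now apply continuous2_primitive. }
assert (HUl : forall x t, continuous (fun x => U x t) x).
{ intros; apply continuous2_l, HUc. }
assert (HKc : forall x t, continuous2 K x t).
{ intros; apply continuous2_frac; trivial; lra. }
assert (HUd : forall x t, is_derive (U x) t (u x t)).
{ intros; now apply is_derive_prim. }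
assert (HU0 : forall x t, t <= 0 -> U x t = 0).
{ intros; apply RInt_nonpos_0; trivial; intros; now apply Hu0. }
assert (HUK : forall t, 0 < t < T -> RInt (fun x => U x t * K x t) 0 1 <= 0).
{ intros t Ht.
  set (Q := (fun e => RInt (fun x => (U x t - U x e) * (K x t - K x e)) 0 1)
    : R -> R).
  assert (HQ0 : Q 0 = RInt (fun x => U x t * K x t) 0 1).
  { apply RInt_ext_R; intros x.
    assert (HK0 : K x 0 = 0).
    { unfold K, frac; rewrite RInt_eq0; [ring | lra | ].
      intros r _; apply Hu0; pose proof (rho_ge0 beta r); lra. }
    rewrite HK0, (HU0 x 0) by lra; ring. }
  assert (HQc : continuous Q 0).
  { assert (Hcc : forall p : R * R, continuous (fun p : R * R =>
        (U (snd p) t - U (snd p) (fst p)) * (K (snd p) t - K (snd p) (fst p))) p).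
    { intros p; apply @continuous_mult; apply @continuous_minus.
      - apply (continuous_comp snd (fun x => U x t));
          [apply continuous_snd | apply HUl].
      - apply (continuous2_comp U snd fst);
          [apply HUc | apply continuous_snd | apply continuous_fst].
      - apply (continuous_comp snd (fun x => K x t));
          [apply continuous_snd | apply continuous2_l, HKc].
      - apply (continuous2_comp K snd fst);
          [apply HKc | apply continuous_snd | apply continuous_fst]. }
    apply (continuous_RInt_param
      (fun e x => (U x t - U x e) * (K x t - K x e))); [lra | | ].
    - intros; apply Hcc.
    - apply filter_forall; intros e; apply ex_RInt_cont; intros x.
      apply (continuous2_r (fun e x => (U x t - U x e) * (K x t - K x e)) e x).
      apply Hcc. }
  rewrite <- HQ0; apply Rnot_lt_le; intros Hpos.
  destruct (HQc (fun y => 0 < y) (locally_gt 0 (Q 0) Hpos)) as [d Hdel].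
  set (e := Rmin (d / 2) (t / 2)).
  pose proof (cond_pos d) as Hdpos.
  assert (He1 : e <= d / 2) by apply Rmin_l.
  assert (He2 : e <= t / 2) by apply Rmin_r.
  assert (He0 : 0 < e) by (apply Rmin_pos; lra).
  assert (HQe : 0 < Q e).
  { apply Hdel; change (Rabs (e - 0) < d).
    rewrite Rminus_0_r, Rabs_pos_eq; lra. }
  assert (HQe' : Q e <= 0).
  { apply (energy_increment_le0 alpha T c u ux uxx uxxx ut e t); trivial;
      try lra; apply Hlim; lra. }
  lra. }
assert (HprodC : forall f : R -> R -> R, (forall x t, continuous2 f x t) ->
  forall s x t, continuous2 (fun t x => U x s * f x t) t x).
{ intros f Hf s x t; apply @continuous_mult.
  - apply (continuous_comp snd (fun x => U x s));
      [apply continuous_snd | apply HUl].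
  - apply (continuous2_comp f snd fst);
      [apply Hf | apply continuous_snd | apply continuous_fst]. }
set (E := (fun t => RInt (fun x => U x t * U x t) 0 1) : R -> R).
assert (HEex : forall s t, ex_RInt (fun x => U x s * U x t) 0 1).
{ intros s t; apply ex_RInt_cont; intros x; now apply @continuous_mult. }
assert (HE0 : forall t, t < T -> E t <= 0).
{ intros t1 Ht1; apply Rnot_lt_le; intros Hpos.
  assert (HEneg : forall t, t <= 0 -> E t = 0).
  { intros t Ht; apply RInt_eq0; [lra | intros x _].
    rewrite HU0 by easy; ring. }
  assert (Ht1p : 0 < t1).
  { apply Rnot_le_lt; intros Hle; rewrite HEneg in Hpos; lra. }
  destruct (continuity_ab_maj E 0 t1 (Rlt_le _ _ Ht1p)) as [t0 [Hmax Ht0]].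
  { intros t _; apply continuity_pt_filterlim.
    apply (continuous_RInt_param (fun t x => U x t * U x t)); [lra | | ].
    - intros x _; apply @continuous_mult; apply (continuous2_comp U snd fst);
        (apply HUc || apply continuous_snd || apply continuous_fst).
    - apply filter_forall; intros s; apply HEex. }
  assert (HEt0 : 0 < E t0) by (pose proof (Hmax t1 ltac:(lra)); lra).
  assert (Ht0p : 0 < t0).
  { apply Rnot_le_lt; intros Hle; rewrite HEneg in HEt0; lra. }
  set (phi := (fun s => RInt (fun x => U x t0 * U x s) 0 1) : R -> R).
  set (dphi := (fun s => RInt (fun x => U x t0 * u x s) 0 1) : R -> R).
  assert (Hphi : 0 < frac beta q dphi t0).
  { apply (frac_max_gt0 beta q t0 phi dphi); trivial.
    - lra.
    - intros s; apply (is_derive_RInt_param_loc (fun s x => U x t0 * U x s)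
        (fun s x => U x t0 * u x s) 0 1 s 1); try lra.
      + intros r x _ _; apply is_derive_scal, HUd.
      + intros x _; now apply (HprodC u).
      + apply filter_forall; intros; apply HEex.
    - intros s; apply (continuous_RInt_param (fun s x => U x t0 * u x s)).
      + lra.
      + intros x _; now apply (HprodC u).
      + apply filter_forall; intros r; apply ex_RInt_cont; intros x.
        apply (continuous2_r (fun s x => U x t0 * u x s)); now apply HprodC.
    - intros s Hs; apply RInt_eq0; [lra | intros x _].
      rewrite (HU0 x s) by easy; ring.
    (* From [2 a b <= a^2 + b^2], [2 * phi s <= E t0 + E s <= 2 * E t0]: a maximum of the energy [E]
       is also a maximum of the linearised quantity [phi]. *)
    - intros s Hs; change (phi t0) with (E t0).
      assert (HEs : E s <= E t0).
      { destruct (Rle_dec s 0) as [Hs0 | Hs0].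
        - rewrite HEneg by easy; lra.
        - apply Hmax; lra. }
      assert (Hsum : RInt (fun x => plus (U x t0 * U x t0) (U x s * U x s)) 0 1 =
        E t0 + E s).
      { apply (RInt_plus (V := R_CompleteNormedModule)); apply HEex. }
      assert (Hdbl : RInt (fun x => plus (U x t0 * U x s) (U x t0 * U x s)) 0 1 =
        phi s + phi s).
      { apply (RInt_plus (V := R_CompleteNormedModule)); apply HEex. }
      assert (Hle : RInt (fun x => plus (U x t0 * U x s) (U x t0 * U x s)) 0 1 <=
        RInt (fun x => plus (U x t0 * U x t0) (U x s * U x s)) 0 1).
      { apply RInt_le; [lra | | | ].
        - apply (ex_RInt_plus (V := R_CompleteNormedModule)); apply HEex.
        - apply (ex_RInt_plus (V := R_CompleteNormedModule)); apply HEex.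
        - intros x _; change plus with Rplus.
          pose proof (Rle_0_sqr (U x t0 - U x s)); unfold Rsqr in *; lra. }
      lra. }
  (* Exchanging the space integral with the history integral identifies the Caputo derivative of
     [phi] with the quantity already shown to be nonpositive. *)
  assert (Hswap : frac beta q dphi t0 = RInt (fun x => U x t0 * K x t0) 0 1).
  { unfold frac, dphi.
    rewrite (RInt_swap (fun r x => U x t0 * u x (t0 - rho beta r)));
      [ | lra | lra | ].
    - rewrite <- RInt_scal_R.
      + apply RInt_ext_R; intros x.
        rewrite (RInt_scal_R (fun r => u x (t0 - rho beta r))).
        * unfold K, frac; ring.
        * apply ex_RInt_cont; intros r; apply continuous_shift_rho; trivial; lra.
      + apply ex_RInt_cont; intros x.
        apply (continuous_ext (fun x => U x t0 * (/ beta * K x t0))).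
        { intros y; change (U y t0 * (/ beta * K y t0) =
            RInt (fun r => U y t0 * u y (t0 - rho beta r)) 0 q :> R).
          unfold K, frac.
          rewrite (RInt_scal_R (fun r => u y (t0 - rho beta r))).
          - field; lra.
          - apply ex_RInt_cont; intros r; apply continuous_shift_rho; trivial; lra. }
        apply @continuous_mult; trivial.
        apply (continuous_scal_r (/ beta) (fun x => K x t0)), continuous2_l, HKc.
    - intros r x; apply @continuous_mult.
      + apply (continuous_comp snd (fun x => U x t0));
          [apply continuous_snd | apply HUl].
      + apply (continuous2_comp u snd (fun p : R * R => t0 - rho beta (fst p))).
        * apply Hu.
        * apply continuous_snd.
        * apply @continuous_minus; [apply continuous_const | ].
          apply (continuous_comp fst (rho beta)).
          apply continuous_fst. apply continuous_rho; lra. }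
  pose proof (HUK t0 ltac:(lra)); lra. }
intros x t Hx Ht.
destruct (Req_dec x 0) as [-> | Hx0]; [apply HuL | ].
destruct (Req_dec x 1) as [-> | Hx1]; [apply HuR | ].
assert (HUz : forall s, s < T -> U x s = 0).
{ intros s Hs; apply Rsqr_eq_0.
  apply (RInt_nonneg_eq0 (fun x => U x s * U x s) 0 1).
  - intros y; now apply @continuous_mult.
  - intros y; apply Rle_0_sqr.
  - now apply HE0.
  - lra. }
rewrite <- (is_derive_unique _ _ _ (HUd x t)).
apply is_derive_unique, (is_derive_ext_loc (fun _ => 0)).
- generalize (locally_lt T t Ht); apply filter_imp; intros s Hs.
  symmetry; now apply HUz.
- apply @is_derive_const.
Qed.

(** * From regular solutions to the homogeneous problem *)

Lemma is_derive_within_locally (D : R -> Prop) (g : R -> R) (x l : R) :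
  locally x D -> is_derive_within D g x l -> is_derive g x l.
Proof.
intros HD [Hlin Hdom]; split; [exact Hlin | ].
intros y Hy eps.
assert (Hy' : is_filter_lim (within D (locally x)) y).
{ intros P HP; apply filter_le_within; now apply Hy. }
unfold within in Hdom.
generalize (filter_and _ _ HD (Hdom y Hy' eps)); apply filter_imp.
intros z [H1 H2]; now apply H2.
Qed.

(** Serves at [x = 0], to identify the continuous [u_x] of the regularity class with the prescribed
    datum. Both difference-quotient estimates are compared at one point [x + d / 2] of [D], each
    contributing [eps / 2]. *)
Lemma is_derive_within_unique_right (D : R -> Prop) (g : R -> R) (x l l' : R) :
  at_right x D -> is_derive_within D g x l -> is_derive_within D g x l' ->
  l = l'.
Proof.
intros HD [_ H1] [_ H2].
assert (Hx : is_filter_lim (within D (locally x)) x).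
{ intros P HP; now apply filter_le_within. }
apply Rminus_diag_uniq, Rabs_eq_0, Rle_antisym; [ | apply Rabs_pos].
apply le_epsilon; intros eps Heps; rewrite Rplus_0_l.
assert (He : 0 < eps / 2) by lra.
specialize (H1 x Hx (mkposreal _ He)); specialize (H2 x Hx (mkposreal _ He)).
unfold within in H1, H2; unfold at_right, within in HD.
destruct (filter_and _ _ (filter_and _ _ H1 H2) HD) as [d Hd].
pose proof (cond_pos d) as Hd0.
destruct (Hd (x + d / 2)) as [[Q1 Q2] Q3].
{ change (Rabs (x + d / 2 - x) < d); rewrite Rabs_pos_eq; lra. }
specialize (Q3 ltac:(lra)); specialize (Q1 Q3); specialize (Q2 Q3).
change (Rabs ((g (x + d / 2) - g x) - (x + d / 2 - x) * l) <=
  eps / 2 * Rabs (x + d / 2 - x)) in Q1.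
change (Rabs ((g (x + d / 2) - g x) - (x + d / 2 - x) * l') <=
  eps / 2 * Rabs (x + d / 2 - x)) in Q2.
replace (x + d / 2 - x) with (d / 2) in * by ring.
rewrite (Rabs_pos_eq (d / 2)) in * by lra.
apply Rabs_le_between in Q1; apply Rabs_le_between in Q2.
apply Rabs_le_between; split; nra.
Qed.

(** Nearest-point retraction onto [[a, b]]. Composing with it extends functions from a closed
    rectangle to continuous functions on the plane, so that the integral lemmas can assume
    continuity everywhere. *)
Definition clamp (a b x : R) : R := Rmax a (Rmin b x).

Lemma clamp_bounds (a b x : R) : a <= b -> a <= clamp a b x <= b.
Proof.
intros Hab; split; [apply Rmax_l | ].
apply Rmax_lub; [easy | apply Rmin_l].
Qed.

Lemma clamp_id (a b x : R) : a <= x <= b -> clamp a b x = x.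
Proof. intros H; unfold clamp; rewrite Rmin_right, Rmax_right; lra. Qed.

Lemma clamp_le (a b x : R) : a <= b -> x <= a -> clamp a b x = a.
Proof.
intros Hab H; unfold clamp; apply Rmax_left.
eapply Rle_trans; [apply Rmin_r | easy].
Qed.

Lemma continuous_clamp (a b x : R) : continuous (clamp a b) x.
Proof.
apply (continuous_ext (fun x => (a + (b + x - Rabs (b - x)) / 2 +
  Rabs (a - (b + x - Rabs (b - x)) / 2)) / 2)).
{ intros y; unfold clamp.
  assert (Hmin : Rmin b y = (b + y - Rabs (b - y)) / 2).
  { unfold Rmin; destruct (Rle_dec b y).
    - rewrite Rabs_left1; lra.
    - rewrite Rabs_pos_eq; lra. }
  rewrite <- Hmin; unfold Rmax; destruct (Rle_dec a (Rmin b y)).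
  - rewrite Rabs_left1; lra.
  - rewrite Rabs_pos_eq; lra. }
assert (Habs : forall (f : R -> R) x, continuous f x ->
  continuous (fun x => Rabs (f x)) x).
{ intros f y Hf; apply (continuous_comp f Rabs);
    [easy | apply continuous_Rabs]. }
assert (Hmin : continuous (fun x => (b + x - Rabs (b - x)) / 2) x).
{ apply @continuous_mult; [ | apply continuous_const].
  apply @continuous_minus.
  - apply @continuous_plus; [apply continuous_const | apply continuous_id].
  - apply Habs, @continuous_minus; [apply continuous_const | apply continuous_id]. }
apply @continuous_mult; [ | apply continuous_const].
apply @continuous_plus.
- apply @continuous_plus; [apply continuous_const | apply Hmin].
- apply Habs, @continuous_minus; [apply continuous_const | apply Hmin].
Qed.

(** The clamped point always lies in [D], so continuity relative to [D] is enough, including at its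
    boundary points. *)
Lemma continuous2_clamp (D : R * R -> Prop) (f : R -> R -> R)
    (a b c d x t : R) :
  a <= b -> c <= d -> continuous_on2 D f ->
  (forall y s, a <= y <= b -> c <= s <= d -> D (y, s)) ->
  continuous2 (fun x t => f (clamp a b x) (clamp c d t)) x t.
Proof.
intros Hab Hcd Hf HD.
set (G := fun p : R * R => (clamp a b (fst p), clamp c d (snd p))).
assert (HG : filterlim G (locally (x, t)) (within D (locally (G (x, t))))).
{ intros P HP.
  assert (HGc : filterlim G (locally (x, t)) (locally (G (x, t)))).
  { intros Q [eps HQ].
    assert (H1 : continuous (fun p : R * R => clamp a b (fst p)) (x, t)).
    { apply (continuous_comp fst (clamp a b));
        [apply continuous_fst | apply continuous_clamp]. }
    assert (H2 : continuous (fun p : R * R => clamp c d (snd p)) (x, t)).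
    { apply (continuous_comp snd (clamp c d));
        [apply continuous_snd | apply continuous_clamp]. }
    pose proof (H1 _ (locally_ball _ eps)) as B1.
    pose proof (H2 _ (locally_ball _ eps)) as B2.
    unfold filtermap in *.
    generalize (filter_and _ _ B1 B2); apply filter_imp; intros p [Hp1 Hp2]; apply HQ; now split. }
  pose proof (HGc _ HP) as HGP; unfold filtermap in *.
  generalize HGP; apply filter_imp; intros p Hp; apply Hp.
  apply HD; now apply clamp_bounds. }
apply (filterlim_comp _ _ _ G (fun p : R * R => f (fst p) (snd p)) _ _ _ HG).
apply (Hf (G (x, t))); apply HD; now apply clamp_bounds.
Qed.

Lemma continuous_on2_minus (D : R * R -> Prop) (f g : R -> R -> R) :
  continuous_on2 D f -> continuous_on2 D g ->
  continuous_on2 D (fun x t => f x t - g x t).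
Proof.
intros Hf Hg p Hp; unfold Rminus.
apply (filterlim_comp_2 (G := locally (f (fst p) (snd p)))
  (H := locally (- g (fst p) (snd p)))).
- exact (Hf p Hp).
- apply (filterlim_comp _ _ _ (fun p : R * R => g (fst p) (snd p)) Ropp _
    (locally (g (fst p) (snd p)))); [exact (Hg p Hp) | ].
  apply (filterlim_opp (V := R_NormedModule)).
- apply (filterlim_plus (V := R_NormedModule)).
Qed.

Lemma locally_between (a b x : R) :
  a < x < b -> locally x (fun y => a < y < b).
Proof.
intros H; apply filter_and; [now apply locally_gt | now apply locally_lt].
Qed.

Lemma locally_E1 (T x t : R) :
  0 < x < 1 -> 0 < t < T -> locally (x, t) (Defs.E1 T).
Proof.
intros Hx Ht; apply filter_and.
- exact (continuous_fst x t _ (locally_between 0 1 x Hx)).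
- pose proof (continuous_snd x t _ (locally_between 0 T t Ht)) as Hs.
  unfold filtermap in Hs; generalize Hs; apply filter_imp.
  intros p [Hp1 Hp2]; split; [exact Hp1 | now apply Rlt_le].
Qed.

(** For [t < T] the relative derivatives are ordinary ones; at [t = T] the time derivative is only
    one-sided. The Caputo integral is recorded as a convergent integral [I], a form in which two
    solutions can be subtracted. *)
Lemma regular_solution_interior (alpha T : R) (f : R -> R -> R)
    (phi1 phi2 phi3 : R -> R) (u : R -> R -> R) :
  regular_solution alpha T f phi1 phi2 phi3 u ->
  exists ux uxx uxxx ut I : R -> R -> R,
    (forall x t, 0 < x < 1 -> 0 < t < T ->
       is_derive (fun y => u y t) x (ux x t) /\
       is_derive (fun y => ux y t) x (uxx x t) /\
       is_derive (fun y => uxx y t) x (uxxx x t) /\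
       is_derive (u x) t (ut x t)) /\
    continuous_on2 (Defs.E1 T) ux /\ continuous_on2 (Defs.E1 T) uxx /\
    continuous_on2 (Defs.E1 T) ut /\
    (forall x t, 0 < x < 1 -> 0 < t < T ->
       is_RInt_gen (fun tau => ut x tau / Rpower (t - tau) alpha)
         (at_right 0) (at_left t) (I x t) /\
       / Gamma (1 - alpha) * I x t - uxxx x t = f x t).
Proof.
intros [[[ux [uxx [ut [Hd [_ [Hcx [Hcxx Hct]]]]]]] _] [Heq _]].
exists ux, uxx, (fun x t => Derive_n (fun y => u y t) 3 x), ut,
  (fun x t => RInt_gen (caputo_integrand alpha (u x) t) (at_right 0) (at_left t)).
assert (Hdi : forall x t, 0 < x < 1 -> 0 < t < T ->
  is_derive (fun y => u y t) x (ux x t) /\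
  is_derive (fun y => ux y t) x (uxx x t) /\ is_derive (u x) t (ut x t)).
{ intros x t Hx Ht.
  destruct (Hd x t) as [H1 [H2 H3]]; [split; simpl; lra | ].
  assert (HDx : locally x (fun y => Defs.E1 T (y, t))).
  { generalize (locally_between 0 1 x Hx); apply filter_imp.
    intros y Hy; split; simpl; lra. }
  assert (HDt : locally t (fun s => Defs.E1 T (x, s))).
  { generalize (locally_between 0 T t Ht); apply filter_imp.
    intros y Hy; split; simpl; lra. }
  split; [ | split].
  - exact (is_derive_within_locally _ _ _ _ HDx H1).
  - exact (is_derive_within_locally _ _ _ _ HDx H2).
  - exact (is_derive_within_locally _ _ _ _ HDt H3). }
split; [ | split; [exact Hcx | split; [exact Hcxx | split; [exact Hct | ]]]].
- intros x t Hx Ht; destruct (Hdi x t Hx Ht) as [H1 [H2 H3]].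
  split; [exact H1 | split; [exact H2 | split; [ | exact H3]]].
  destruct (Heq x t) as [_ [Hex _]]; [split; simpl; lra | ].
  (* The equation speaks of the iterated derivative of [u]; it is the derivative of [uxx] because
     [Derive_n] of order 2 equals [uxx] on a whole neighbourhood of [x]. *)
  apply (is_derive_ext_loc (Derive_n (fun y => u y t) 2)).
  + generalize (locally_between 0 1 x Hx); apply filter_imp; intros y Hy.
    simpl; rewrite <- (is_derive_unique _ _ _ (proj1 (proj2 (Hdi y t Hy Ht)))).
    apply Derive_ext_loc.
    generalize (locally_between 0 1 y Hy); apply filter_imp; intros z Hz.
    now apply is_derive_unique, Hdi.
  + exact (Derive_correct _ _ Hex).
- intros x t Hx Ht.
  destruct (Heq x t) as [[_ Hex] [_ Hf]]; [split; simpl; lra | ].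
  split; [ | exact Hf].
  apply (is_RInt_gen_ext (caputo_integrand alpha (u x) t)).
  + exists (fun y => 0 < y < t) (fun y => 0 < y < t).
    * exists (mkposreal t (proj1 Ht)); intros y Hy Hy0.
      change (Rabs (y - 0) < t) in Hy; apply Rabs_def2 in Hy; lra.
    * exists (mkposreal t (proj1 Ht)); intros y Hy Hy0.
      change (Rabs (y - t) < t) in Hy; apply Rabs_def2 in Hy; lra.
    * intros y z Hy Hz tau; simpl.
      apply Rmin_case; apply Rmax_case; intros Htau; unfold caputo_integrand;
        f_equal; apply is_derive_unique, Hdi; lra.
  + exact (RInt_gen_correct _ Hex).
Qed.

Lemma regular_solution_left_derivative (alpha T : R) (f : R -> R -> R)
    (phi1 phi2 phi3 : R -> R) (u : R -> R -> R) :
  regular_solution alpha T f phi1 phi2 phi3 u ->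
  exists p : R -> R -> R,
    continuous_on2 (E1_left T) p /\
    (forall t, 0 < t <= T -> p 0 t = phi2 t) /\
    (forall x t, 0 < x < 1 -> 0 < t <= T -> is_derive (fun y => u y t) x (p x t)).
Proof.
intros [[_ [_ [p [Hp Hpc]]]] [_ [_ Hbd]]].
exists p; split; [exact Hpc | split].
- intros t Ht; apply (is_derive_within_unique_right (fun y => E1_left T (y, t))
    (fun y => u y t) 0).
  + exists (mkposreal 1 Rlt_0_1); intros y Hy Hy0.
    change (Rabs (y - 0) < 1) in Hy; apply Rabs_def2 in Hy.
    split; simpl; lra.
  + apply Hp; split; simpl; lra.
  + now apply Hbd.
- intros x t Hx Ht.
  apply (is_derive_within_locally (fun y => E1_left T (y, t))).
  + generalize (locally_between 0 1 x Hx); apply filter_imp; intros y Hy.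
    split; simpl; lra.
  + apply Hp; split; simpl; lra.
Qed.

Theorem theorem1 :
  forall (alpha T : R) (f : R -> R -> R) (phi1 phi2 phi3 : R -> R),
    0 < alpha < 1 -> 0 < T ->
    forall u1 u2 : R -> R -> R,
      regular_solution alpha T f phi1 phi2 phi3 u1 ->
      regular_solution alpha T f phi1 phi2 phi3 u2 ->
      forall x t, 0 <= x <= 1 -> 0 <= t <= T -> u1 x t = u2 x t.
Proof.
intros alpha T f phi1 phi2 phi3 Ha HT u1 u2 Hs1 Hs2.
destruct (regular_solution_interior _ _ _ _ _ _ _ Hs1) as
  [ux1 [uxx1 [uxxx1 [ut1 [I1 [Hd1 [Hcx1 [Hcxx1 [Hct1 Heq1]]]]]]]]].
destruct (regular_solution_interior _ _ _ _ _ _ _ Hs2) as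
  [ux2 [uxx2 [uxxx2 [ut2 [I2 [Hd2 [Hcx2 [Hcxx2 [Hct2 Heq2]]]]]]]]].
destruct (regular_solution_left_derivative _ _ _ _ _ _ _ Hs1) as
  [p1 [Hpc1 [Hp1 Hpd1]]].
destruct (regular_solution_left_derivative _ _ _ _ _ _ _ Hs2) as
  [p2 [Hpc2 [Hp2 Hpd2]]].
destruct Hs1 as [[_ [Hc1 _]] [_ [Hi1 Hb1]]].
destruct Hs2 as [[_ [Hc2 _]] [_ [Hi2 Hb2]]].
set (w := (fun x t => u1 x t - u2 x t) : R -> R -> R).
set (u := (fun x t => w (clamp 0 1 x) (clamp 0 T t)) : R -> R -> R).
assert (Hu : forall x t, continuous2 u x t).
{ intros x t; apply (continuous2_clamp (E1_closure T)); [lra | lra | | ].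
  - now apply continuous_on2_minus.
  - intros y s Hy Hs; now split. }
assert (Huw : forall x t, 0 <= x <= 1 -> 0 <= t <= T -> u x t = w x t).
{ intros x t Hx Ht; unfold u; now rewrite !clamp_id. }
assert (Hw0 : forall x, 0 <= x <= 1 -> w x 0 = 0).
{ intros x Hx; unfold w; rewrite Hi1, Hi2 by easy; ring. }
assert (Hu0 : forall x t, t <= 0 -> u x t = 0).
{ intros x t Ht; unfold u; rewrite (clamp_le 0 T t) by lra.
  apply Hw0, clamp_bounds; lra. }
assert (HuLR : forall t, u 0 t = 0 /\ u 1 t = 0).
{ intros t; unfold u; rewrite (clamp_id 0 1 0), (clamp_id 0 1 1) by lra.
  (* Boundary data are prescribed only for positive times; at clamped time [0] the initial condition
     takes over. *)
  destruct (clamp_bounds 0 T t ltac:(lra)) as [[Hpos | <-] Hle].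
  - unfold w; destruct (Hb1 (clamp 0 T t)) as [-> [_ ->]]; [lra | ].
    destruct (Hb2 (clamp 0 T t)) as [-> [_ ->]]; [lra | ]; lra.
  - split; apply Hw0; lra. }
assert (Hz : forall x t, 0 <= x <= 1 -> t < T -> u x t = 0).
{ apply (homogeneous_solution_eq0 alpha T (Gamma (1 - alpha)) u
    (fun x t => ux1 x t - ux2 x t) (fun x t => uxx1 x t - uxx2 x t)
    (fun x t => uxxx1 x t - uxxx2 x t) (fun x t => ut1 x t - ut2 x t));
    trivial; try (intros; apply HuLR).
  - apply Gamma_gt0; lra.
  - intros x t Hx Ht.
    destruct (Hd1 x t Hx Ht) as [D1 [D2 [D3 D4]]].
    destruct (Hd2 x t Hx Ht) as [D1' [D2' [D3' D4']]].
    assert (Hmin : forall (g h : R -> R) y a b, is_derive g y a ->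
      is_derive h y b -> is_derive (fun z => g z - h z) y (a - b)).
    { intros g h y a b Hg Hh; exact (is_derive_minus g h y a b Hg Hh). }
    split; [ | split; [ | split]]; try now apply Hmin.
    + apply (is_derive_ext_loc (fun y => w y t)); [ | now apply Hmin].
      generalize (locally_between 0 1 x Hx); apply filter_imp; intros y Hy.
      symmetry; apply Huw; lra.
    + apply (is_derive_ext_loc (w x)); [ | now apply (Hmin (u1 x))].
      generalize (locally_between 0 T t Ht); apply filter_imp; intros y Hy.
      symmetry; apply Huw; lra.
  - intros x t Hx Ht; pose proof (locally_E1 T x t Hx Ht) as HE.
    repeat split; apply (continuous_continuous_on (Defs.E1 T)); trivial;
      now apply continuous_on2_minus.
  - intros x t Hx Ht.
    destruct (Heq1 x t Hx Ht) as [J1 F1]; destruct (Heq2 x t Hx Ht) as [J2 F2].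
    assert (HG : 0 < Gamma (1 - alpha)) by (apply Gamma_gt0; lra).
    (* The common right-hand side [f] cancels in the difference of the two equations. *)
    assert (HI : Gamma (1 - alpha) * (uxxx1 x t - uxxx2 x t) = minus (I1 x t) (I2 x t)).
    { replace (uxxx1 x t - uxxx2 x t) with
        (/ Gamma (1 - alpha) * I1 x t - / Gamma (1 - alpha) * I2 x t) by lra.
      change minus with Rminus; field; lra. }
    rewrite HI.
    apply (is_RInt_gen_ext (fun tau => minus (ut1 x tau / Rpower (t - tau) alpha)
      (ut2 x tau / Rpower (t - tau) alpha))).
    + apply filter_forall; intros ab tau _.
      exact (eq_sym (Rmult_minus_distr_r _ _ _)).
    + now apply (is_RInt_gen_minus (V := R_NormedModule)).
  - intros e t He Ht.
    (* Continuity of [u_x] is available only for [x < 1] and positive times, so space is clamped to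
       [[0, 1 / 2]] and time to [[e, t]]; only small [x] matters for the limit. *)
    set (P := (fun x s => p1 (clamp 0 (1 / 2) x) (clamp e t s) -
      p2 (clamp 0 (1 / 2) x) (clamp e t s)) : R -> R -> R).
    assert (HP : forall x s, continuous2 P x s).
    { intros x s; apply (continuous2_clamp (E1_left T)
        (fun x s => p1 x s - p2 x s)); [lra | lra | | ].
      - now apply continuous_on2_minus.
      - intros y r Hy Hr; split; simpl; lra. }
    assert (HP0 : RInt (P 0) e t = 0).
    { apply RInt_eq0; [lra | intros s Hs; unfold P].
      rewrite !clamp_id, Hp1, Hp2 by lra; ring. }
    assert (HPlim : filterlim (fun x => RInt (P x) e t) (at_right 0)
      (locally (RInt (P 0) e t))).
    { apply (filterlim_at_right (fun x => RInt (P x) e t)), continuous_RInt_param;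
        [lra | | ].
      - intros r _; apply HP.
      - apply filter_forall; intros y; apply ex_RInt_cont; intros s.
        apply continuous2_r, HP. }
    rewrite HP0 in HPlim.
    refine (filterlim_ext_loc (fun x => RInt (P x) e t) _ _ HPlim).
    assert (Hh : 0 < 1 / 2) by lra.
    exists (mkposreal _ Hh); intros x Hx Hx0.
    change (Rabs (x - 0) < 1 / 2) in Hx; apply Rabs_def2 in Hx.
    apply RInt_ext; intros s; rewrite Rmin_left, Rmax_right by lra; intros Hs.
    unfold P; rewrite !clamp_id by lra.
    f_equal; [ | f_equal].
    + rewrite <- (is_derive_unique _ _ _ (proj1 (Hd1 x s ltac:(lra) ltac:(lra)))).
      symmetry; apply is_derive_unique, Hpd1; lra.
    + rewrite <- (is_derive_unique _ _ _ (proj1 (Hd2 x s ltac:(lra) ltac:(lra)))).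
      symmetry; apply is_derive_unique, Hpd2; lra. }
intros x t Hx Ht; apply Rminus_diag_uniq; fold (w x t).
rewrite <- Huw by easy.
(* The final time is reached by continuity from the left, since the argument runs on [t < T]. *)
destruct (Req_dec t T) as [-> | HtT]; [ | apply Hz; lra].
apply (filterlim_unique_R (at_left T) (u x)).
- apply filterlim_at_left, continuous2_r, Hu.
- apply (filterlim_ext_loc (fun _ => 0)); [ | apply filterlim_const].
  unfold at_left, within.
  apply filter_forall; intros s Hs; symmetry; now apply Hz.
Qed.
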